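(* Let $K\ge 2$, $\gamma\in(0,1)$, $\alpha\in[1,2]$, $\eta\in(0,1]$ and $\mu\in\mathcal G^*$. Let $R=R(K,\alpha)>0$ be the constant in the threshold $\beta(t,\delta)=\log(Rt^\alpha/\delta)$. There exist an event $\mathcal E$ with $\mathbb P_\mu(\mathcal E)\ge 1-\gamma$ and a number $\delta_0=\delta_0(\mu,K,\gamma,\eta,\alpha)>0$ such that for every $0<\delta\le\delta_0$, the Exploration-Biased Sampling strategy with parameters $\delta,\gamma$ and threshold $\beta$ has a stopping time $\tau_\delta$ satisfying $$\mathbb P_\mu(\{\tau_\delta>t\}\cap\mathcal E)\le 2Kt\exp\Bigl(-\frac{t\,w_{\min}(\mu)}{4T(\mu)^2}\,\frac{1}{(\log(1/\delta))^{2/3}}\Bigr)\qquad\text{for every integer } t>(1+\eta)T(\mu)\log(1/\delta),$$ and $$\mathbb E_\mu[\tau_\delta\mathbf 1_{\mathcal E}]\le(1+\eta)T(\mu)\log(1/\delta)+\frac{2^7K\,T(\mu)^4}{w_{\min}(\mu)^2}\exp\Bigl(-\frac{w_{\min}(\mu)}{4T(\mu)}(\log(1/\delta))^{1/3}\Bigr)(\log(1/\delta))^2 .$$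
   Context: Bandits. $[K]=\{1,\dots,K\}$. $\mathcal G$ is the set of Gaussian bandits with $K$ arms, unit variances and means $\mu\in[0,1]^K$; arm $a$ has law $\mathcal N(\mu_a,1)$. $\mathcal G^*\subset\mathcal G$ is the set of $\mu$ whose maximal coordinate is attained at a unique arm $a^*(\mu)$. $\Sigma_K=\{v\in[0,1]^K:\sum_a v_a=1\}$. For $\mu\in\mathcal G^*$, $\mathrm{Alt}(\mu)=\{\lambda\in\mathcal G^*:a^*(\lambda)\ne a^*(\mu)\}$ and $$T(\mu)^{-1}=\sup_{v\in\Sigma_K}\inf_{\lambda\in\mathrm{Alt}(\mu)}\sum_{a\in[K]}v_a\frac{(\mu_a-\lambda_a)^2}{2}=\sup_{v\in\Sigma_K}\frac12\min_{a\ne a^*(\mu)}\frac{v_{a^*(\mu)}v_a}{v_{a^*(\mu)}+v_a}(\mu_{a^*(\mu)}-\mu_a)^2 ;$$ $w(\mu)\in\Sigma_K$ is the unique maximizer $v$. If $\mu$ has several maximal arms, $w(\mu)$ is the uniform distribution on the set of maximal arms. The same definition (last formula) is used for $w(\nu)$ with $\nu\in\mathbb R^K$. $w_{\min}(\mu)=\min_a w_a(\mu)$. Exploration-Biased Weights. Input: a product of intervals $\prod_{a}[\underline\mu_a,\overline\mu_a]$. Put $\mathrm{maxLB}=\max_a\underline\mu_a$, $\mathrm{minUB}=\min_a\overline\mu_a$. If $\mathrm{minUB}\ge\mathrm{maxLB}$, output $\tilde\mu=(\mathrm{minUB},\dots,\mathrm{minUB})$ and $w=(1/K,\dots,1/K)$.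 Otherwise, for each $a$ with $\overline\mu_a>\mathrm{maxLB}$ let $\tilde\mu^{(a)}$ be the vector with $\tilde\mu^{(a)}_a=\overline\mu_a$ and $\tilde\mu^{(a)}_b=\max(\underline\mu_b,\mathrm{minUB})$ for $b\ne a$; output a $\tilde\mu=\tilde\mu^{(a)}$ maximizing $\min_b w_b(\tilde\mu^{(a)})$ over such $a$ (the first one in case of ties) together with $w=w(\tilde\mu)$. Exploration-Biased Sampling with parameters $\delta,\gamma\in(0,1)$ and threshold $\beta(t,\delta)$. At each time $t$ an arm $A_t$ is chosen from past observations and an independent draw $Y_t\sim\mathcal N(\mu_{A_t},1)$ is observed. $N_a(t)=\sum_{s=1}^t\mathbf 1_{A_s=a}$, $\hat\mu_a(t)=N_a(t)^{-1}\sum_{s=1}^tY_s\mathbf 1_{A_s=a}$. Each arm is observed once during the first $K$ rounds; $\tilde w(s)=(1/K,\dots,1/K)$ for $0\le s\le K-1$. For $t\ge K$ let $\mathcal{CR}_\mu(t)=\prod_a[\hat\mu_a(t)-C_{\gamma/K}(N_a(t)),\hat\mu_a(t)+C_{\gamma/K}(N_a(t))]$ with $C_\gamma(s)=2\sqrt{\log(4s/\gamma)/s}$, let $(\tilde\mu(t),\tilde w(t))$ be the output of Exploration-Biased Weights on $\mathcal{CR}_\mu(t)$, and choose $A_{t+1}\in\arg\min_a\bigl(N_a(t)-\sum_{s=1}^t\tilde w_a(s)\bigr)$. With $$Z_{a,b}(t)=\tfrac12\tfrac{N_a(t)N_b(t)}{N_a(t)+N_b(t)}(\hat\mu_a(t)-\hat\mu_b(t))|\hat\mu_a(t)-\hat\mu_b(t)|,\qquad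 Z(t)=\max_a\min_{b\ne a}Z_{a,b}(t),$$ the strategy stops at $\tau_\delta=\inf\{t\ge K:Z(t)>\beta(t,\delta)\}$ and outputs $\arg\max_a\hat\mu_a(\tau_\delta)$. The sampling rule does not depend on $\delta$, so all $\tau_\delta$ live on the same probability space. $\mathbb P_\mu,\mathbb E_\mu$ refer to the bandit with means $\mu$. *)

(* Defs.v *)
From HB Require Import structures.
From mathcomp Require Import all_boot all_order all_algebra.
From mathcomp Require Import all_classical all_reals all_analysis.
Set Implicit Arguments.
Unset Strict Implicit.
Unset Printing Implicit Defensive.
Import Order.TTheory GRing.Theory Num.Theory.
Import numFieldNormedType.Exports.
Local Open Scope classical_set_scope.
Local Open Scope ring_scope.

(* Gaussian bandits with unit variances are identified with their vector of
   means nu : 'I_K -> R.  Rounds are numbered from 1: in a process indexed by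
   nat, the value at index 0 is never used. *)

(* [inf] and [sup] of a finite family; a genuine minimum and maximum as soon
   as the family is nonempty, which always holds below when 2 <= K. *)
Definition fmin (R : realType) (I : finType) (P : pred I) (f : I -> R) : R :=
  inf [set f i | i in [set i | P i]].

Definition fmax (R : realType) (I : finType) (P : pred I) (f : I -> R) : R :=
  sup [set f i | i in [set i | P i]].

(* [Some a] if the maximal coordinate of nu is attained at a only, and [None]
   if it is attained several times. *)
Definition best_arm (R : realType) (K : nat) (nu : 'I_K -> R) : option 'I_K :=
  [pick a | [forall b, (b != a) ==> (nu b < nu a)]].

Definition gaussian_bandits (R : realType) (K : nat) : set ('I_K -> R) :=
  [set mu | forall a, 0 <= mu a <= 1].

Definition unique_best_bandits (R : realType) (K : nat) : set ('I_K -> R) :=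
  [set mu | gaussian_bandits mu /\ best_arm mu <> None].

Definition Alt (R : realType) (K : nat) (mu : 'I_K -> R) : set ('I_K -> R) :=
  [set lam | unique_best_bandits lam /\ best_arm lam <> best_arm mu].

Definition simplex (R : realType) (K : nat) : set ('I_K -> R) :=
  [set v | (forall a, 0 <= v a <= 1) /\ \sum_a v a = 1].

Definition Tchar (R : realType) (K : nat) (mu : 'I_K -> R) : R :=
  (sup [set inf [set \sum_a v a * ((mu a - lam a) ^+ 2 / 2) | lam in Alt mu]
       | v in @simplex R K])^-1.

(* The explicit form of the infimum over [Alt] for best arm a; the quotient is
   0 when v a = v b = 0, by the convention x / 0 = 0. *)
Definition info_rate (R : realType) (K : nat) (nu : 'I_K -> R) (a : 'I_K)
    (v : 'I_K -> R) : R :=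
  2^-1 * fmin (fun b => b != a)
              (fun b => v a * v b / (v a + v b) * (nu a - nu b) ^+ 2).

Definition uniform_weights (R : realType) (K : nat) : 'I_K -> R :=
  fun _ => K%:R^-1.

(* The maximizer of the first case exists and is unique, so the default value
   given to [xget] plays no role. *)
Definition opt_weights (R : realType) (K : nat) (nu : 'I_K -> R) : 'I_K -> R :=
  if best_arm nu is Some a then
    xget (@uniform_weights R K)
         [set v | simplex v /\
                  forall v', simplex v' -> info_rate nu a v' <= info_rate nu a v]
  else
    let maximal := [set a | [forall b, nu b <= nu a]]%SET in
    fun a => if a \in maximal then #|maximal|%:R^-1 else 0.

Definition wmin (R : realType) (K : nat) (nu : 'I_K -> R) : R :=
  fmin predT (opt_weights nu).

Definition optimistic_means (R : realType) (K : nat) (lo up : 'I_K -> R)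
    (a : 'I_K) : 'I_K -> R :=
  fun b => if b == a then up a else Num.max (lo b) (fmin predT up).

(* The box is the product of the intervals [lo a, up a]; the output is the
   pair (mu~, w).  The last branch is not reached when lo a < up a for all
   a. *)
Definition exploration_biased_weights (R : realType) (K : nat)
    (lo up : 'I_K -> R) : ('I_K -> R) * ('I_K -> R) :=
  let maxLB := fmax predT lo in
  let minUB := fmin predT up in
  let mut := optimistic_means lo up in
  let optimal a :=
    (maxLB < up a) &&
    [forall b, (maxLB < up b) ==> (wmin (mut b) <= wmin (mut a))] in
  if maxLB <= minUB then (fun=> minUB, @uniform_weights R K)
  else if [pick a | optimal a && [forall b, optimal b ==> (a <= b)%N]]
          is Some a
       then (mut a, opt_weights (mut a))
       else (fun=> minUB, @uniform_weights R K).

Definition conf_radius (R : realType) (g : R) (s : nat) : R :=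
  2 * Num.sqrt (ln (4 * s%:R / g) / s%:R).

Section Process.
Context {R : realType} {K : nat} {T : Type}.
Variables (A : nat -> T -> 'I_K) (Y : nat -> T -> R).

Definition pulls (a : 'I_K) (t : nat) (x : T) : nat :=
  (\sum_(1 <= s < t.+1) (A s x == a))%N.

Definition emp_mean (a : 'I_K) (t : nat) (x : T) : R :=
  (pulls a t x)%:R^-1 * \sum_(1 <= s < t.+1 | A s x == a) Y s x.

Definition past (t : nat) : set (set T) :=
  <<s [set E | exists s, (1 <= s <= t)%N /\
        ((exists a, E = A s @^-1` [set a]) \/
         (exists2 B : set R, measurable B & E = Y s @^-1` B))] >>.

Definition conf_lo (gamma : R) (t : nat) (x : T) : 'I_K -> R :=
  fun a => emp_mean a t x - conf_radius (gamma / K%:R) (pulls a t x).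

Definition conf_up (gamma : R) (t : nat) (x : T) : 'I_K -> R :=
  fun a => emp_mean a t x + conf_radius (gamma / K%:R) (pulls a t x).

Definition ebs_weights (gamma : R) (t : nat) (x : T) : 'I_K -> R :=
  if (t < K)%N then @uniform_weights R K
  else (exploration_biased_weights (conf_lo gamma t x) (conf_up gamma t x)).2.

Definition tracking_gap (gamma : R) (t : nat) (x : T) (a : 'I_K) : R :=
  (pulls a t x)%:R - \sum_(1 <= s < t.+1) ebs_weights gamma s x a.

(* Neither the order of the first K rounds nor the resolution of ties in the
   argmin is prescribed. *)
Record ebs_sampling (gamma : R) : Prop := EbsSampling {
  ebs_init : forall x a, pulls a K x = 1%N ;
  ebs_track : forall t x, (K <= t)%N ->
    forall b, tracking_gap gamma t x (A t.+1 x) <= tracking_gap gamma t x b }.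

Definition Zpair (a b : 'I_K) (t : nat) (x : T) : R :=
  let na := (pulls a t x)%:R in
  let nb := (pulls b t x)%:R in
  let d := emp_mean a t x - emp_mean b t x in
  2^-1 * (na * nb / (na + nb)) * d * `|d|.

Definition Zstat (t : nat) (x : T) : R :=
  fmax predT (fun a => fmin (fun b => b != a) (fun b => Zpair a b t x)).

(* [+oo] if the strategy never stops. *)
Definition stop_time (beta : nat -> R) (x : T) : \bar R :=
  ereal_inf [set t%:R%:E | t in [set t : nat | (K <= t)%N /\ beta t < Zstat t x]].

End Process.

(* The conditional law of the reward Y_{t+1} given the past and A_{t+1} is
   N(mu_{A_{t+1}}, 1). *)
Record bandit_run (R : realType) (K : nat) (mu : 'I_K -> R)
    (d : measure_display) (T : measurableType d) (P : probability T R)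
    (A : nat -> T -> 'I_K) (Y : nat -> {RV P >-> R}) : Prop := BanditRun {
  run_arm : forall t a, past A Y t (A t.+1 @^-1` [set a]) ;
  run_reward : forall t a (E : set T) (B : set R),
    past A Y t E -> measurable B ->
    P (E `&` A t.+1 @^-1` [set a] `&` Y t.+1 @^-1` B) =
    (P (E `&` A t.+1 @^-1` [set a]) * normal_prob (mu a) 1 B)%E }.

Definition log_threshold (R : realType) (c alpha delta : R) (t : nat) : R :=
  ln (c * t%:R `^ alpha / delta).

(* Main.v *)
(** The whole statement is deterministic on one event. Let E be the event that at every time t >= K
every empirical mean is within its confidence radius of the true mean; exponential supermartingales,
frozen after the n-th pull of an arm, and a union bound over arms and numbers of pulls give
P(E) >= 1 - gamma. On E:
- the optimistic candidate of the best arm has gaps whose ratio is bounded, so its optimal weights,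
  and hence all weights played, are bounded below by a constant w0 > 0;
- tracking then makes every arm pulled at least w0 t - K times, the confidence regions shrink to mu at
  a deterministic speed, and from some deterministic time on the weights played are nearly optimal
  for mu;
- x y / (x + y) is superadditive, nondecreasing and homogeneous, so the empirical proportions are
  nearly optimal as well, and Z(t) >= (1 - eta / 6) (t - B) / T(mu) for a constant B.
This linear lower bound crosses log (c t^alpha / delta) before (1 + eta) T(mu) log (1 / delta) once
delta is small. Hence tau_delta <= (1 + eta) T(mu) log (1 / delta) on E, the first probability is 0
and the first term alone bounds the expectation. *)
Require Import Defs.
From HB Require Import structures.
From mathcomp Require Import all_boot all_order all_algebra.
From mathcomp Require Import all_classical all_reals all_analysis.
From mathcomp Require Import measurable_realfun.
From mathcomp Require Import ring lra.
Set Implicit Arguments.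
Unset Strict Implicit.
Unset Printing Implicit Defensive.
Import Order.TTheory GRing.Theory Num.Theory.
Import numFieldNormedType.Exports.
Local Open Scope classical_set_scope.
Local Open Scope ring_scope.

(** * Finite extrema, x y / (x + y), confidence radii *)

Section FiniteExtrema.
Context {R : realType} {I : finType}.
Implicit Types (P : pred I) (f : I -> R).

Lemma fmin_attained P f i0 : P i0 -> exists2 i, P i & fmin P f = f i.
Proof.
move=> Pi0; have [i Pi imin] := @arg_minP _ _ I i0 P f Pi0; exists i => //.
apply/eqP; rewrite eq_le; apply/andP; split.
- by apply: ge_inf; [exists (f i) => _ [j /= Pj <-]; exact: imin | exists i].
- by apply: lb_le_inf; [exists (f i), i | move=> _ [j /= Pj <-]; exact: imin].
Qed.

Lemma fmin_le P f i : P i -> fmin P f <= f i.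
Proof.
move=> Pi; have [j Pj jmin] := @arg_minP _ _ I i P f Pi.
by apply: ge_inf; [exists (f j) => _ [k /= Pk <-]; exact: jmin | exists i].
Qed.

Lemma fmin_ge P f x i0 : P i0 -> (forall i, P i -> x <= f i) -> x <= fmin P f.
Proof. by move=> Pi0 xf; have [i Pi ->] := fmin_attained f Pi0; exact: xf. Qed.

Lemma fmax_ge P f i : P i -> f i <= fmax P f.
Proof.
move=> Pi; have [j Pj jmax] := @arg_maxP _ _ I i P f Pi.
by apply: sup_upper_bound; [split;
  [exists (f i), i | exists (f j) => _ [k /= Pk <-]; exact: jmax] | exists i].
Qed.

Lemma fmax_attained P f i0 : P i0 -> exists2 i, P i & fmax P f = f i.
Proof.
move=> Pi0; have [i Pi imax] := @arg_maxP _ _ I i0 P f Pi0; exists i => //.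
apply/eqP; rewrite eq_le fmax_ge // andbT.
by apply: ge_sup; [exists (f i), i | move=> _ [j /= Pj <-]; exact: imax].
Qed.

End FiniteExtrema.

Section HalfHarmonicMean.
Context {R : realType}.
Implicit Types x y k : R.

(** The minimum over [z] of [x (p - z)^2 + y (q - z)^2] for [x, y >= 0] and [|p - q| = 1]; at
    [x = y = 0] it is 0 because [0 / 0 = 0]. *)
Definition harm x y := x * y / (x + y).

Lemma harmC x y : harm x y = harm y x.
Proof. by rewrite /harm [x * y]mulrC [x + y]addrC. Qed.

Lemma harm_ge0 x y : 0 <= x -> 0 <= y -> 0 <= harm x y.
Proof. by move=> x0 y0; rewrite /harm divr_ge0 ?mulr_ge0 ?addr_ge0. Qed.

Lemma harm_le x y : 0 <= x -> 0 <= y -> harm x y <= x.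
Proof.
move=> x0 y0; rewrite /harm.
have [->|xy] := eqVneq (x + y) 0; first by rewrite invr0 mulr0.
have xy0 : 0 < x + y by rewrite lt_neqAle eq_sym xy addr_ge0.
by rewrite ler_pdivrMr // ler_wpM2l // lerDr.
Qed.

Lemma harm_homo x y x' y' : 0 < x -> 0 < y -> x <= x' -> y <= y' ->
  harm x y <= harm x' y'.
Proof.
move=> x0 y0 xx yy.
have x'0 : 0 < x' by exact: lt_le_trans xx.
have y'0 : 0 < y' by exact: lt_le_trans yy.
rewrite /harm ler_pdivrMr ?addr_gt0 // mulrAC ler_pdivlMr ?addr_gt0 //.
have -> : x * y * (x' + y') = x * x' * y + y * y' * x by ring.
have -> : x' * y' * (x + y) = x * x' * y' + y * y' * x' by ring.
by apply: lerD; rewrite ler_wpM2l // mulr_ge0 // ltW.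
Qed.

Lemma harmZ k x y : k != 0 -> harm (k * x) (k * y) = k * harm x y.
Proof.
move=> k0; rewrite /harm -mulrDr invfM.
have -> : k * x * (k * y) * (k^-1 * (x + y)^-1) =
  k * k^-1 * (k * (x * y * (x + y)^-1)) by ring.
by rewrite divff // mul1r.
Qed.

(** This is concavity for a function homogeneous of degree 1. It lets the rates of successive rounds
    be added into a rate of the cumulated weights. *)
Lemma harm_superadditive x y x' y' : 0 < x -> 0 < y -> 0 < x' -> 0 < y' ->
  harm x y + harm x' y' <= harm (x + x') (y + y').
Proof.
move=> x0 y0 x'0 y'0; rewrite -subr_ge0 /harm.
have -> : (x + x') * (y + y') / (x + x' + (y + y')) -
  (x * y / (x + y) + x' * y' / (x' + y')) =
  (x * y' - x' * y) ^+ 2 / ((x + y) * (x' + y') * (x + x' + (y + y'))).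
  by field; repeat (apply/andP; split); rewrite gt_eqF // ?addr_gt0.
by rewrite divr_ge0 ?sqr_ge0 // ltW // !mulr_gt0 // !addr_gt0.
Qed.

End HalfHarmonicMean.

Section LogBounds.
Context {R : realType}.

Lemma ln_le_linear (k : R) : 0 < k ->
  exists C, forall x, 0 < x -> ln x <= k * x + C.
Proof.
move=> k0; exists (ln k^-1) => x x0.
have {1}-> : x = (k * x) * k^-1 by rewrite mulrAC divff ?mul1r // gt_eqF.
by rewrite lnM ?posrE ?mulr_gt0 ?invr_gt0 // lerD2r ltW // ln_sublinear ?mulr_gt0.
Qed.

Lemma eventually_ln_lt (k C : R) : 0 < k ->
  exists n0 : nat, forall n : nat, (n0 <= n)%N -> 2 * ln n%:R + C < k * n%:R.
Proof.
(* Slope [k / 4] for [ln] becomes [k / 2] after doubling; the other half of [k] absorbs the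
   constant. *)
move=> k0; have k4 : 0 < k / 4 by rewrite divr_gt0.
have [D hD] := ln_le_linear k4.
have := archi_boundP (normr_ge0 (2 * (2 * D + C) / k)).
set n0 := Num.bound _ => hn0; exists n0.+1 => n n0n.
have n_gt0 : 0 < n%:R :> R by rewrite ltr0n (leq_trans _ n0n).
have nbig : 2 * (2 * D + C) / k < n%:R.
  apply: le_lt_trans (ler_norm _) _; apply: lt_le_trans hn0 _.
  by rewrite ler_nat (leq_trans (leqnSn _) n0n).
by move: nbig (hD _ n_gt0); rewrite ltr_pdivrMr //; nra.
Qed.

(** Since [ln y <= y], the quotient under the root is at most [4 / g] whatever [n]; confidence
    regions thus have a deterministic maximal size. *)
Lemma conf_radius_le (g : R) (n : nat) : 0 < g -> (0 < n)%N ->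
  conf_radius g n <= 2 * Num.sqrt (4 / g).
Proof.
move=> g0 n0; have nR : 0 < n%:R :> R by rewrite ltr0n.
rewrite /conf_radius ler_wpM2l // ler_wsqrtr // ler_pdivrMr //.
by rewrite ltW // mulrAC ln_sublinear // mulr_gt0 // divr_gt0.
Qed.

Lemma conf_radius_gt0 (g : R) (n : nat) : 0 < g < 4 -> (0 < n)%N ->
  0 < conf_radius g n.
Proof.
move=> /andP[g0 g4] n0; have nR : 1 <= n%:R :> R by rewrite ler1n.
rewrite /conf_radius mulr_gt0 // sqrtr_gt0 divr_gt0 ?(lt_le_trans _ nR) //.
by apply: ln_gt0; rewrite ltr_pdivlMr //; nra.
Qed.

Lemma conf_radius_cvg0 (g e : R) : 0 < g -> 0 < e ->
  exists n0 : nat, forall n : nat, (n0 <= n)%N -> conf_radius g n <= e.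
Proof.
(* [2 sqrt z <= e] follows from [z <= e^2 / 4]; the inequality is doubled to fit [2 ln n]. *)
move=> g0 e0; have [n0 hn0] := @eventually_ln_lt (e ^+ 2 / 2) (2 * ln (4 / g))
  ltac:(by rewrite divr_gt0 // exprn_gt0).
exists n0.+1 => n n0n; have n_gt0 : 0 < n%:R :> R by rewrite ltr0n (leq_trans _ n0n).
have {hn0} := hn0 _ (leq_trans (leqnSn _) n0n).
rewrite -mulrDr addrC -lnM ?posrE ?divr_gt0 // mulrAC => lnlt.
have eE : 2 * Num.sqrt ((e / 2) ^+ 2) = e.
  by rewrite sqrtr_sqr ger0_norm ?divr_ge0 ?ltW // mulrC divfK.
rewrite /conf_radius -eE ler_wpM2l // ler_wsqrtr // ler_pdivrMr // expr_div_n.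
have : 2 * ln (4 * n%:R / g) <= 2 * (e ^+ 2 / 2 ^+ 2 * n%:R).
  by apply: le_trans (ltW lnlt) _; rewrite le_eqVlt; apply/orP; left; apply/eqP; field.
by rewrite ler_pM2l.
Qed.

End LogBounds.

(** * Optimal weights *)

Section OptimalWeights.
Context {R : realType} {K : nat}.
Implicit Types (nu v : 'I_K -> R) (a b : 'I_K).

Lemma best_arm_some nu a : (forall b, b != a -> nu b < nu a) -> best_arm nu = Some a.
Proof.
move=> best; rewrite /best_arm; case: pickP => [a' /forallP best'|/(_ a) /forallP[]].
  have [->//|aa'] := eqVneq a' a.
  have := best _ aa'; have := best' a; rewrite eq_sym aa' /= => /lt_trans h /h.
  by rewrite ltxx.
by move=> b; apply/implyP; exact: best.
Qed.

Lemma best_arm_max nu a : best_arm nu = Some a -> forall b, b != a -> nu b < nu a.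
Proof.
rewrite /best_arm; case: pickP => // a' /forallP best [<-] b ba.
exact: (implyP (best b)).
Qed.

Hypothesis K_ge2 : (2 <= K)%N.

Let K_gt0 : 0 < K%:R :> R. Proof. by rewrite ltr0n (leq_trans _ K_ge2). Qed.

Lemma exists_other a : exists b, b != a.
Proof.
have : (0 < #|predC1 a|)%N by rewrite cardC1 card_ord -ltnS prednK // (leq_trans _ K_ge2).
by case/card_gt0P => b; exists b.
Qed.

Lemma exists_gap nu a : (forall b, b != a -> nu b < nu a) ->
  exists gap, 0 < gap /\ forall b, b != a -> gap <= nu a - nu b.
Proof.
move=> best; have [b0 b0a] := exists_other a; pose gaps b := nu a - nu b.
exists (fmin (fun b => b != a) gaps); split; last first.
  by move=> b ba; exact: (@fmin_le _ _ (fun b => b != a) gaps).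
have [b ba ->] := @fmin_attained _ _ (fun b => b != a) gaps b0 b0a.
by rewrite subr_gt0 best.
Qed.

Lemma uniform_simplex : simplex (@uniform_weights R K).
Proof.
split=> [a|]; last first.
  by rewrite /uniform_weights sumr_const card_ord -[LHS]mulr_natl divff // gt_eqF.
by rewrite invr_ge0 ler0n invf_le1 // ler1n (leq_trans _ K_ge2).
Qed.

Lemma info_rate_le nu v a b : b != a ->
  info_rate nu a v <= 2^-1 * (harm (v a) (v b) * (nu a - nu b) ^+ 2).
Proof. by move=> ba; rewrite ler_pM2l ?invr_gt0 //; exact: fmin_le. Qed.

Lemma le_info_rate nu v a x :
  (forall b, b != a -> x <= 2^-1 * (harm (v a) (v b) * (nu a - nu b) ^+ 2)) ->
  x <= info_rate nu a v.
Proof.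
have [b0 b0a] := exists_other a => hx.
rewrite /info_rate mulrC -ler_pdivrMr ?invr_gt0 //.
apply: (@fmin_ge _ _ (fun b => b != a) _ _ b0 b0a) => b /hx.
by rewrite mulrC -ler_pdivrMr ?invr_gt0.
Qed.

Lemma uniform_rate_ge nu a m : 0 <= m ->
  (forall b, b != a -> m <= nu a - nu b) ->
  2^-1 * (m ^+ 2 / (2 * K%:R)) <= info_rate nu a (@uniform_weights R K).
Proof.
move=> m0 gap; apply: le_info_rate => b ba; rewrite ler_pM2l ?invr_gt0 //.
have -> : harm (uniform_weights R a) (uniform_weights R b) = (2 * K%:R)^-1 :> R.
  by rewrite /harm /uniform_weights; field; rewrite gt_eqF.
by rewrite mulrC ler_pM2l ?invr_gt0 ?mulr_gt0 // lerXn2r ?nnegrE ?(le_trans m0) ?gap.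
Qed.

(* Beating the uniform weights bounds every [harm (v a) (v b)] below, and
   [harm x y] is at most [x] and [y]. *)
Lemma near_optimal_ge nu a v m M : simplex v -> 0 < m ->
  (forall b, b != a -> m <= nu a - nu b <= M) ->
  info_rate nu a (@uniform_weights R K) <= info_rate nu a v ->
  forall b, m ^+ 2 / (2 * K%:R * M ^+ 2) <= v b.
Proof.
move=> [v01 v1] m0 gap vopt.
have key b : b != a -> m ^+ 2 / (2 * K%:R * M ^+ 2) <= harm (v a) (v b).
  move=> ba; have /andP[mgap gapM] := gap _ ba.
  have M0 : 0 < M by apply: lt_le_trans m0 (le_trans mgap gapM).
  rewrite invfM mulrA ler_pdivrMr ?exprn_gt0 //.
  have := le_trans (uniform_rate_ge (ltW m0) (fun b' b'a => proj1 (andP (gap b' b'a)))) vopt.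
  move/le_trans/(_ (info_rate_le nu v ba)); rewrite ler_pM2l ?invr_gt0 // => /le_trans.
  apply; apply: ler_wpM2l; first by apply: harm_ge0; [case/andP: (v01 a)|case/andP: (v01 b)].
  by rewrite lerXn2r ?nnegrE ?(le_trans _ mgap) ?(ltW m0) ?(ltW M0).
have v0 c : 0 <= v c by case/andP: (v01 c).
move=> b; have [->|ba] := eqVneq b a; last first.
  by apply: le_trans (key _ ba) _; rewrite harmC harm_le.
by have [c ca] := exists_other a; apply: le_trans (key _ ca) _; rewrite harm_le.
Qed.

Lemma fmin_continuous (T : topologicalType) (P : pred 'I_K) (i0 : 'I_K)
    (f : T -> 'I_K -> R) (x : T) :
  P i0 -> (forall i, P i -> {for x, continuous (fun y => f y i)}) ->
  {for x, continuous (fun y => fmin P (f y))}.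
Proof.
move=> Pi0 fc; apply/cvgrPdist_le => e e0.
have : \forall y \near x, forall i : 'I_K, P i -> `|f x i - f y i| <= e.
  apply: filter_forall => i; have [Pi|nPi] := boolP (P i); last by near=> y.
  by have /cvgrPdist_le /(_ _ e0) := fc _ Pi; apply: filterS => y.
apply: filterS => y fxy; rewrite ler_distl; apply/andP; split.
- have [j Pj ->] := fmin_attained (f x) Pi0; have := fmin_le (f y) Pj.
  by have := fxy _ Pj; rewrite ler_distl => /andP[]; lra.
- have [j Pj ->] := fmin_attained (f y) Pi0; have := fmin_le (f x) Pj.
  by have := fxy _ Pj; rewrite ler_distl => /andP[]; lra.
Unshelve. all: by end_near. Qed.

(** Weights are passed to row vectors for the compactness and extreme value arguments. *)
Definition of_row (v : 'rV[R]_K) : 'I_K -> R := fun a => v ord0 a.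

Lemma of_row_continuous a : continuous (fun v : 'rV[R]_K => of_row v a).
Proof. exact: coord_continuous. Qed.

Lemma sum_of_row_continuous : continuous (fun v : 'rV[R]_K => \sum_a of_row v a).
Proof.
elim: (index_enum _) => [|a s IH].
  rewrite (_ : (fun v : 'rV[R]_K => _) = (fun=> 0)); first exact: cst_continuous.
  by apply/funext => v; rewrite big_nil.
rewrite (_ : (fun v : 'rV[R]_K => _) = (fun v : 'rV[R]_K => of_row v a + \sum_(b <- s) of_row v b)).
  by move=> v; exact: (cvgD (@of_row_continuous a v) (IH v)).
by apply/funext => v; rewrite big_cons.
Qed.

Lemma info_rate_continuous nu a (v : 'rV[R]_K) : (forall b, 0 < of_row v b) ->
  {for v, continuous (fun v : 'rV[R]_K => info_rate nu a (of_row v))}.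
Proof.
move=> v0; have [b0 b0a] := exists_other a.
have c b : {for v, continuous (fun v : 'rV[R]_K => of_row v b)} by exact: of_row_continuous.
have cg b : b != a ->
    {for v, continuous (fun v : 'rV[R]_K => harm (of_row v a) (of_row v b) * (nu a - nu b) ^+ 2)}.
  move=> ba; have sum_neq0 : of_row v a + of_row v b != 0 by rewrite gt_eqF // addr_gt0.
  exact: (cvgM (cvgM (cvgM (c a) (c b)) (cvgV sum_neq0 (cvgD (c a) (c b)))) (cvg_cst _)).
exact: (cvgM (cvg_cst _) (fmin_continuous b0a cg)).
Qed.

(* By [near_optimal_ge], only weights bounded away from 0 compete: the rate is
   continuous there, which it need not be where [v a + v b = 0]. *)
Lemma exists_optimal nu a : (forall b, b != a -> nu b < nu a) ->
  exists v, simplex v /\ forall v', simplex v' -> info_rate nu a v' <= info_rate nu a v.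
Proof.
move=> best; have [b0 b0a] := exists_other a.
have [m [m0 mgap]] := exists_gap best.
pose M := fmax (fun b => b != a) (fun b => nu a - nu b).
have gap b : b != a -> m <= nu a - nu b <= M.
  move=> ba; rewrite mgap //= /M.
  exact: (@fmax_ge _ _ (fun b => b != a) (fun b => nu a - nu b) b ba).
have M0 : 0 < M by case/andP: (gap _ b0a) => mg gM; apply: lt_le_trans m0 (le_trans mg gM).
pose c := m ^+ 2 / (2 * K%:R * M ^+ 2).
have c0 : 0 < c by rewrite divr_gt0 ?mulr_gt0 ?exprn_gt0.
pose S := [set v : 'rV[R]_K | (forall a, `[c, 1%R]%classic (v ord0 a))] `&`
  (fun v : 'rV[R]_K => \sum_a of_row v a) @^-1` [set 1].
have Sge (v : 'rV[R]_K) : S v -> forall b, c <= of_row v b <= 1.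
  by case=> vc _ b; have := vc b; rewrite /= in_itv.
pose uni : 'rV[R]_K := \row_b uniform_weights R b.
have S_row v : simplex v -> info_rate nu a (@uniform_weights R K) <= info_rate nu a v ->
    S (\row_b v b) /\ of_row (\row_b v b) = v.
  move=> sv uv; have E : of_row (\row_b v b) = v :> ('I_K -> R).
    by apply/funext => b; rewrite /of_row mxE.
  split=> //; split=> [b|]; last by rewrite /= E; exact: sv.2.
  rewrite /= in_itv /= mxE; case/andP: (sv.1 b) => _ ->; rewrite andbT.
  exact: (near_optimal_ge sv m0 gap uv).
have cS : compact S.
  apply: compact_closedI.
    apply: (@rV_compact _ _ (fun _ => `[c, 1%R]%classic)) => i; exact: segment_compact.
  apply: preimage_closed => [v _|]; first exact: sum_of_row_continuous.
  exact: closed_eq.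
have Sc : {within S, continuous (fun v : 'rV[R]_K => info_rate nu a (of_row v))}.
  apply: continuous_in_subspaceT => v; rewrite inE => Sv; apply: info_rate_continuous.
  by move=> b; apply: lt_le_trans c0 _; case/andP: (Sge _ Sv b).
have [Su uE] := S_row _ uniform_simplex (lexx _).
have [v] := EVT_max_rV (ex_intro _ _ Su) cS Sc.
rewrite inE => Sv vmax; exists (of_row v); split.
  split=> [b|]; last exact: Sv.2.
  by have /andP[cb ->] := Sge _ Sv b; rewrite (le_trans (ltW c0) cb).
move=> v' sv'; set rate_u := info_rate nu a (@uniform_weights R K).
(* Weights worse than uniform may lie outside [S], but the uniform weights lie in [S] and beat
   them. *)
have [uv'|/ltW v'u] := leP rate_u (info_rate nu a v').
  by have [Sv' {1}<-] := S_row _ sv' uv'; apply: vmax; rewrite inE.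
by apply: le_trans v'u _; rewrite /rate_u -{1}uE; apply: vmax; rewrite inE.
Qed.

Lemma opt_weights_optimal nu a : (forall b, b != a -> nu b < nu a) ->
  simplex (opt_weights nu) /\
  forall v', simplex v' -> info_rate nu a v' <= info_rate nu a (opt_weights nu).
Proof.
move=> best; rewrite /opt_weights (best_arm_some best).
have [v [sv vmax]] := exists_optimal best.
by apply: (xgetPex _ (P := [set v | simplex v /\ forall v', simplex v' -> _ v' <= _ v])); exists v.
Qed.

Lemma opt_weights_ge nu a m M : 0 < m ->
  (forall b, b != a -> m <= nu a - nu b <= M) ->
  forall b, m ^+ 2 / (2 * K%:R * M ^+ 2) <= opt_weights nu b.
Proof.
move=> m0 gap; have best b : b != a -> nu b < nu a.
  by move=> /gap /andP[+ _]; rewrite -subr_gt0; exact: lt_le_trans.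
have [sv vmax] := opt_weights_optimal best.
exact: near_optimal_ge sv m0 gap (vmax _ uniform_simplex).
Qed.

End OptimalWeights.

(** * Exploration-biased weights *)

Section ExplorationBiasedWeights.
Context {R : realType} {K : nat}.
Hypothesis K_ge2 : (2 <= K)%N.
Variables (lo up mu : 'I_K -> R) (a : 'I_K).

Let K_gt0 : 0 < K%:R :> R. Proof. by rewrite ltr0n (leq_trans _ K_ge2). Qed.

Let maxLB := fmax predT lo.
Let minUB := fmin predT up.
Let mut := optimistic_means lo up.

(** Every coordinate other than [c] is at most [maxLB], as both [lo b] and [minUB] are. *)
Lemma optimistic_means_best c : minUB < maxLB -> maxLB < up c ->
  forall b, b != c -> mut c b < mut c c.
Proof.
move=> mM Mc b bc; rewrite /mut /optimistic_means eqxx (negbTE bc) gt_max.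
by rewrite (le_lt_trans _ Mc) ?(lt_trans mM) // (fmax_ge lo (P := predT)).
Qed.

Lemma exploration_biased_weights_optimistic c : minUB < maxLB -> maxLB < up c ->
  exists c', [/\ maxLB < up c', wmin (mut c) <= wmin (mut c') &
    (exploration_biased_weights lo up).2 = opt_weights (mut c')].
Proof.
move=> mM Mc; rewrite /exploration_biased_weights leNgt mM /=.
pose optimal d := (maxLB < up d) &&
  [forall b, (maxLB < up b) ==> (wmin (mut b) <= wmin (mut d))].
have [d Md dmax] := @arg_maxP _ _ _ c (fun d => maxLB < up d) (fun d => wmin (mut d)) Mc.
have optd : optimal d by rewrite /optimal Md; apply/forallP => b; apply/implyP; exact: dmax.
case: pickP => [c' /andP[/andP[Mc' /forallP c'max] _]|none].
  by exists c'; split=> //; exact: (implyP (c'max c)).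
(* The default branch is excluded: among the candidates of maximal [wmin], the one of least index
   passes the test of [pick]. *)
have [e opte emin] := @arg_minnP _ d optimal (fun i => i) optd.
have : optimal e && [forall b, optimal b ==> (e <= b)%N] = false := none e.
rewrite opte /= => /negbT /forallPn[b].
by rewrite negb_imply => /andP[optb]; rewrite emin.
Qed.

Hypothesis lo_up : forall b, lo b < up b.
Hypothesis in_box : forall b, lo b <= mu b <= up b.

(* The candidate optimistic for [a] has gaps [min (up a - lo b) (up a - minUB)],
   whose ratio is at most [D / gap]; the selected candidate has a larger [wmin]. *)
Lemma exploration_biased_weights_ge (gap D : R) : 0 < gap ->
  (forall b, b != a -> gap <= mu a - mu b) -> (forall b, up a - mu b <= D) ->
  simplex (exploration_biased_weights lo up).2 /\
  forall b, gap ^+ 2 / (2 * K%:R * D ^+ 2) <= (exploration_biased_weights lo up).2 b.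
Proof.
move=> gap0 hgap hD.
have [b0 b0a] := exists_other K_ge2 a.
have gapD : gap <= D.
  apply: le_trans (hgap _ b0a) (le_trans _ (hD b0)).
  by rewrite lerD2r; case/andP: (in_box a).
have D0 : 0 < D by exact: lt_le_trans gapD.
have gapD1 : gap ^+ 2 / (2 * K%:R * D ^+ 2) <= (2 * K%:R)^-1.
  rewrite invfM mulrCA ler_piMr ?invr_ge0 ?mulr_ge0 ?(ltW K_gt0) //.
  by rewrite ler_pdivrMr ?exprn_gt0 // mul1r lerXn2r ?nnegrE ?(ltW gap0) ?(ltW D0).
have [Mm|mM] := leP maxLB minUB.
  rewrite /exploration_biased_weights Mm /=; split; first exact: uniform_simplex.
  move=> b; apply: le_trans gapD1 _.
  rewrite /uniform_weights invfM ler_piMl ?invr_ge0 ?(ltW K_gt0) //.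
  by rewrite invf_le1 ?ler1n.
(* Arm [a] is itself a candidate: [lo b <= mu b < mu a <= up a] for [b != a]. *)
have Ma : maxLB < up a.
  rewrite /maxLB; have [b _ ->] := @fmax_attained _ _ predT lo a isT.
  have [->//|ba] := eqVneq b a.
  have := hgap _ ba; case/andP: (in_box a) => _; case/andP: (in_box b) => + _; lra.
have [c [Mc wc ->]] := exploration_biased_weights_optimistic mM Ma.
have [sc _] := opt_weights_optimal K_ge2 (optimistic_means_best mM Mc).
split=> // b; apply: le_trans (_ : wmin (mut c) <= _); last first.
  exact: (@fmin_le _ _ predT (opt_weights (mut c)) b).
apply: le_trans wc; apply: (@fmin_ge _ _ predT _ _ b) => // {}b _.
pose g := up a - minUB.
have g0 : 0 < g by rewrite subr_gt0 (lt_trans mM).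
have gD : g <= D.
  rewrite /g /minUB; have [d _ ->] := @fmin_attained _ _ predT up a isT.
  by apply: le_trans (hD d); rewrite lerD2l lerN2; case/andP: (in_box d).
pose m := Num.min gap g.
have m0 : 0 < m by rewrite /m lt_min gap0.
have mg : forall d, d != a -> m <= mut a a - mut a d <= g.
  move=> d da; rewrite /mut /optimistic_means eqxx (negbTE da) -/minUB; apply/andP; split.
    rewrite lerBrDr -lerBrDl ge_max; apply/andP; split.
      rewrite lerBrDl -lerBrDr ge_min; apply/orP; left.
      by have := hgap _ da; case/andP: (in_box a) => _; case/andP: (in_box d) => + _; lra.
    by rewrite lerBrDl -lerBrDr ge_min lexx orbT.
  by rewrite lerD2l lerN2 le_max lexx orbT.
apply: le_trans (opt_weights_ge K_ge2 m0 mg b).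
(* The ratio [m / g] is [gap / g >= gap / D] in the first case and 1 in the second, where [gapD1]
   concludes. *)
rewrite /m; have [gapg|ggap] := leP gap g.
  apply: ler_wpM2l; first by rewrite sqr_ge0.
  rewrite lef_pV2 ?posrE ?mulr_gt0 ?exprn_gt0 //.
  by rewrite ler_wpM2l ?mulr_ge0 ?(ltW K_gt0) // lerXn2r ?nnegrE ?(ltW g0) ?(ltW D0).
suff -> : g ^+ 2 / (2 * K%:R * g ^+ 2) = (2 * K%:R)^-1 by [].
by field; rewrite !gt_eqF.
Qed.

(** With errors below half the gap, the lower bound of [a] exceeds all other upper bounds, so [a] is
    the only candidate. Its optimistic means stay within [e] of [mu] because [minUB <= up b]. *)
Lemma exploration_biased_weights_near (e : R) :
  (forall b, b != a -> 2 * e < mu a - mu b) ->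
  (forall b, mu b - e <= lo b) -> (forall b, up b <= mu b + e) ->
  exists nu, (exploration_biased_weights lo up).2 = opt_weights nu /\
  (forall b, b != a -> nu b < nu a) /\ forall b, `|nu b - mu b| <= e.
Proof.
move=> gap loe upe; have [b0 b0a] := exists_other K_ge2 a.
have Mlo : mu a - e <= maxLB.
  by apply: le_trans (loe a) _; exact: (@fmax_ge _ _ predT).
have mM : minUB < maxLB.
  apply: lt_le_trans Mlo; apply: le_lt_trans (_ : up b0 < _).
    exact: (@fmin_le _ _ predT).
  by have := gap _ b0a; have := upe b0; lra.
have Mc c : maxLB < up c -> c = a.
  move=> Mc; apply/eqP; apply: contraT => /gap; have := upe c; lra.
have Ma : maxLB < up a.
  rewrite /maxLB; have [b _ ->] := @fmax_attained _ _ predT lo a isT.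
  have [->//|ba] := eqVneq b a.
  have := gap _ ba; case/andP: (in_box a) => ma au; case/andP: (in_box b) => lb bu.
  have := loe b; have := upe b; lra.
have [c [/Mc -> _ ->]] := exploration_biased_weights_optimistic mM Ma.
exists (mut a); split=> //; split; first exact: optimistic_means_best.
move=> b; rewrite /mut /optimistic_means; case: eqP => [->|_].
  by rewrite ler_norml; have := upe a; case/andP: (in_box a); have := loe a; lra.
have := loe b; have := upe b; case/andP: (in_box b) => h1 h2 h3 h4.
rewrite ler_distl; apply/andP; split; first by rewrite le_max h4.
rewrite ge_max; apply/andP; split; first lra.
by apply: le_trans h3; exact: (@fmin_le _ _ predT).
Qed.

End ExplorationBiasedWeights.

(** * Characteristic time *)

Section CharacteristicTime.
Context {R : realType} {K : nat}.
Hypothesis K_ge2 : (2 <= K)%N.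
Variables (mu : 'I_K -> R) (a : 'I_K).
Hypothesis mu01 : gaussian_bandits mu.
Hypothesis a_best : forall b, b != a -> mu b < mu a.

Let K_gt0 : 0 < K%:R :> R. Proof. by rewrite ltr0n (leq_trans _ K_ge2). Qed.

Let mu_a_le1 : mu a <= 1. Proof. by case/andP: (mu01 a). Qed.

(** The point [x] is the weighted mean of [mu a] and [mu b], the cheapest common value for the two
    arms; if both weights vanish, any point between them serves. *)
Lemma weighted_mean_cost (va vb : R) b : b != a -> 0 <= va -> 0 <= vb ->
  exists x, [/\ mu b <= x, x <= mu a &
    va * (mu a - x) ^+ 2 + vb * (mu b - x) ^+ 2 = harm va vb * (mu a - mu b) ^+ 2].
Proof.
move=> ba va0 vb0; have lt_ba := a_best ba.
have [s0|s0] := eqVneq (va + vb) 0.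
  exists (mu b); split=> //; first exact: ltW.
  move: s0 => /eqP; rewrite paddr_eq0 // => /andP[/eqP-> /eqP->].
  by rewrite /harm !mul0r addr0.
have s_gt0 : 0 < va + vb by rewrite lt_neqAle eq_sym s0 addr_ge0.
exists ((va * mu a + vb * mu b) / (va + vb)); split.
- by rewrite ler_pdivlMr //; nra.
- by rewrite ler_pdivrMr //; nra.
- by rewrite /harm; field.
Qed.

(* Equalizing [a] and [b] at [x] may tie several arms, and [x] may be 1; moving
   by at most [s] makes one arm other than [a] the unique best, inside [0, 1]. *)
Lemma alt_near b (x s : R) : b != a -> mu b <= x -> x <= mu a -> 0 < s <= 1 ->
  exists lam, Alt mu lam /\
  forall i, `|lam i - (if (i == a) || (i == b) then x else mu i)| <= s.
Proof.
move=> ba bx xa /andP[s0 s1]; have lt_ba := a_best ba.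
have mu_b_ge0 : 0 <= mu b by case/andP: (mu01 b).
(* This is strictly below [mu a] even when [x = mu a], which leaves room under 1 for the bump
   [t]. *)
pose x' := x - s * (x - mu b).
have x'b : mu b <= x' by rewrite /x'; nra.
have d1 : x - mu b <= 1 by have := mu_a_le1; lra.
have x's : x - s <= x' by rewrite /x' lerD2l lerN2 ler_piMr // ltW.
have x'x : x' <= x by rewrite /x' lerBlDr lerDl mulr_ge0 ?subr_ge0 // ltW.
have x'a : x' < mu a by rewrite /x'; nra.
pose lam' i := if (i == a) || (i == b) then x' else mu i.
(* The best arm other than [a]; it also dominates [a], since [lam' a = lam' b]. *)
have [c ca cmax] := @arg_maxP _ _ _ b (fun i => i != a) lam' ba.
have lam'_ge0 i : 0 <= lam' i.
  by rewrite /lam'; case: ifP => _; [exact: le_trans x'b | case/andP: (mu01 i)].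
have lam'_lt i : lam' i <= mu a.
  rewrite /lam'; case: ifP => [_|/norP[ia _]]; first exact: ltW.
  exact/ltW/a_best.
have c_lt1 : lam' c < 1.
  apply: lt_le_trans mu_a_le1; rewrite /lam'; case: ifP => // /norP[+ _].
  exact: a_best.
pose t := Num.min s (1 - lam' c).
have t0 : 0 < t by rewrite lt_min s0 subr_gt0.
have ts : t <= s by rewrite ge_min lexx.
have tc : lam' c + t <= 1 by rewrite -lerBrDl ge_min lexx orbT.
exists (fun i => lam' i + (if i == c then t else 0)); split; last first.
  move=> i; rewrite ler_distl; case: (i == c); rewrite /lam'; case: ifP => _ /=;
  by apply/andP; split; lra.
have lam_best i : i != c -> lam' i + (if i == c then t else 0) <
    lam' c + (if c == c then t else 0).
  move=> ic; rewrite (negbTE ic) eqxx addr0; apply: le_lt_trans (_ : lam' c < _).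
    have [->|ia] := eqVneq i a; last exact: cmax.
    have -> : lam' a = lam' b by rewrite /lam' !eqxx orbT.
    exact: cmax.
  by rewrite ltrDl.
have bestE := @best_arm_some _ _ (fun i => lam' i + (if i == c then t else 0)) c lam_best.
split; last by rewrite bestE (best_arm_some a_best) => -[] /eqP; apply/negP.
split; last by rewrite bestE.
move=> i; have := lam'_ge0 i; have := lam'_lt i.
by have := mu_a_le1; case: eqP => [->|_] *; apply/andP; split; lra.
Qed.

(** Moving [a] and [b] to their weighted mean costs exactly the right-hand side. That bandit may
    fall outside [Alt mu], so it is approached by members of [Alt mu], at an extra cost that tends
    to 0. *)
Lemma alt_cost_le v b : simplex v -> b != a ->
  inf [set \sum_i v i * ((mu i - lam i) ^+ 2 / 2) | lam in Alt mu] <=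
  2^-1 * (harm (v a) (v b) * (mu a - mu b) ^+ 2).
Proof.
move=> [v01 v1] ba; have v0 i : 0 <= v i by case/andP: (v01 i).
have [x [bx xa <-]] := weighted_mean_cost ba (v0 a) (v0 b).
apply/ler_addgt0Pr => e e0; pose s := Num.min 1 (e / 2).
have s01 : 0 < s <= 1 by rewrite lt_min ltr01 divr_gt0 //= ge_min lexx.
have se : s <= e / 2 by rewrite ge_min lexx orbT.
have [lam [Alam lamx]] := alt_near ba bx xa s01.
apply: le_trans (_ : \sum_i v i * ((mu i - lam i) ^+ 2 / 2) <= _).
  apply: ge_inf; last by exists lam.
  exists 0 => _ [l _ <-]; apply: sumr_ge0 => i _.
  by rewrite mulr_ge0 // divr_ge0 // sqr_ge0.
pose lam0 i := if (i == a) || (i == b) then x else mu i.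
(* For [|p| <= 1] and [|q| <= s <= 1], [(p + q)^2 / 2 <= p^2 / 2 + s + s / 2]. *)
apply: le_trans (_ : \sum_i (v i * ((mu i - lam0 i) ^+ 2 / 2) + v i * (3 / 2 * s)) <= _).
  apply: ler_sum => i _; rewrite -mulrDr ler_wpM2l //.
  have := lamx i; rewrite -/(lam0 i) ler_distl => /andP[l1 l2].
  have d1 : -1 <= mu i - lam0 i <= 1.
    have := mu01 a; have := mu01 b; have := mu01 i; rewrite /lam0.
    by case: ifP => _ /andP[? ?] /andP[? ?] /andP[? ?]; apply/andP; split; lra.
  case/andP: s01 => s0 s1; case/andP: d1 => d1 d2.
  have : (lam0 i - lam i) * (mu i - lam0 i) <= s by nra.
  have : (lam0 i - lam i) ^+ 2 <= s by nra.
  have -> : (mu i - lam i) ^+ 2 = (mu i - lam0 i) ^+ 2 +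
    2 * ((lam0 i - lam i) * (mu i - lam0 i)) + (lam0 i - lam i) ^+ 2 by ring.
  lra.
rewrite big_split /= -mulr_suml v1 mul1r.
rewrite (bigD1 a) //= (bigD1 b) //= big1 => [|i /andP[ia ib]]; last first.
  by rewrite /lam0 (negbTE ia) (negbTE ib) subrr expr0n /= mul0r mulr0.
rewrite /lam0 !eqxx orbT /=; case/andP: s01 => s0 s1; lra.
Qed.

(** This direction of the duality turns a lower bound by the explicit rate into one by
    [1 / T(mu)]. *)
Lemma inv_Tchar_le : (Tchar mu)^-1 <= info_rate mu a (opt_weights mu).
Proof.
rewrite /Tchar invrK; apply: ge_sup.
  by exists (inf [set \sum_i uniform_weights R i * ((mu i - lam i) ^+ 2 / 2) | lam in Alt mu]),
    (@uniform_weights R K) => //; exact: uniform_simplex.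
move=> _ [v sv <-]; apply: le_trans (_ : info_rate mu a v <= _).
  by apply: le_info_rate => // b ba; exact: alt_cost_le.
exact: (opt_weights_optimal K_ge2 a_best).2.
Qed.

(** If [c] is best for [lam], then [lam a < lam c] while [mu a - mu c >= gap], so the displacements
    of [a] and [c] add up to at least [gap] and their squares to at least [gap^2 / 2]. *)
Lemma alt_separation lam (gap : R) : (forall b, b != a -> gap <= mu a - mu b) ->
  0 < gap -> Alt mu lam ->
  gap ^+ 2 / (4 * K%:R) <= \sum_i uniform_weights R i * ((mu i - lam i) ^+ 2 / 2).
Proof.
move=> hgap gap0 [[_ some] diff]; case E : (best_arm lam) some diff => [c|//] _.
rewrite (best_arm_some a_best) => ca.
have {}ca : c != a by apply/eqP => ca'; apply: ca; rewrite ca'.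
have lt_ac := best_arm_max E (_ : a != c); rewrite eq_sym in lt_ac.
rewrite -mulr_sumr (bigD1 a) //= (bigD1 c) //=.
set rest := \sum_(_ | _) _.
have rest0 : 0 <= rest by apply: sumr_ge0 => i _; rewrite divr_ge0 ?sqr_ge0.
have := hgap _ ca; have := lt_ac ca => h1 h2.
have : gap ^+ 2 / 2 <= (mu a - lam a) ^+ 2 + (mu c - lam c) ^+ 2.
  have pq : gap <= (mu a - lam a) + (lam c - mu c) by lra.
  have pq2 : gap ^+ 2 <= ((mu a - lam a) + (lam c - mu c)) ^+ 2.
    by rewrite lerXn2r ?nnegrE ?(le_trans (ltW gap0)).
  have := sqr_ge0 ((mu a - lam a) - (lam c - mu c)); nra.
move=> h; rewrite /uniform_weights mulrC invfM -mulrA [leRHS]mulrC.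
have -> : 4^-1 * (K%:R^-1 * gap ^+ 2) = gap ^+ 2 / 4 * K%:R^-1.
  by rewrite mulrCA mulrC [_ * 4^-1]mulrC.
rewrite ler_pM2r ?invr_gt0 //; lra.
Qed.

Lemma Tchar_gt0 : 0 < Tchar mu.
Proof.
rewrite /Tchar invr_gt0; have [b0 b0a] := exists_other K_ge2 a.
have [gap [gap0 hgap]] := exists_gap K_ge2 a_best.
(* [Alt mu] must be shown nonempty, since the infimum of the empty set is 0 by convention. *)
have [|lam [Alam _]] := @alt_near b0 (mu b0) 1 b0a (lexx _) (ltW (a_best b0a)).
  by rewrite ltr01 lexx.
apply: lt_le_trans (_ : gap ^+ 2 / (4 * K%:R) <= _).
  by rewrite divr_gt0 ?exprn_gt0 ?mulr_gt0.
apply: le_trans (_ : inf [set \sum_i uniform_weights R i * ((mu i - lam i) ^+ 2 / 2)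
                         | lam in Alt mu] <= _).
  apply: lb_le_inf.
    by exists (\sum_i uniform_weights R i * ((mu i - lam i) ^+ 2 / 2)), lam.
  by move=> _ [l Al <-]; exact: alt_separation.
apply: sup_upper_bound; last by exists (@uniform_weights R K) => //; exact: uniform_simplex.
split.
  by exists (inf [set \sum_i uniform_weights R i * ((mu i - lam i) ^+ 2 / 2) | lam in Alt mu]),
    (@uniform_weights R K) => //; exact: uniform_simplex.
(* The family of infima must also be bounded above for [sup] to be a genuine supremum. *)
exists (info_rate mu a (opt_weights mu)) => _ [v sv <-].
apply: le_trans (_ : info_rate mu a v <= _).
  by apply: le_info_rate => // b ba; exact: alt_cost_le.
exact: (opt_weights_optimal K_ge2 a_best).2.
Qed.

End CharacteristicTime.

(** The rate is quadratic in the gaps. This serves to pass from [mu] to a nearby bandit and back. *)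
Lemma info_rate_scale (R : realType) (K : nat) (nu nu' v : 'I_K -> R) (a : 'I_K) (k : R) :
  (2 <= K)%N -> (forall b, 0 <= v b) -> 0 <= k ->
  (forall b, b != a -> 0 <= nu a - nu b /\ k * (nu a - nu b) <= nu' a - nu' b) ->
  k ^+ 2 * info_rate nu a v <= info_rate nu' a v.
Proof.
move=> K2 v0 k0 gaps; apply: le_info_rate => // b ba; have [g0 kg] := gaps b ba.
apply: le_trans (_ : k ^+ 2 * (2^-1 * (harm (v a) (v b) * (nu a - nu b) ^+ 2)) <= _).
  by rewrite ler_wpM2l ?sqr_ge0 // info_rate_le.
rewrite mulrCA [k ^+ 2 * _]mulrCA -exprMn ler_pM2l ?invr_gt0 //.
rewrite ler_wpM2l ?harm_ge0 // lerXn2r ?nnegrE ?mulr_ge0 //.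
by apply: le_trans kg; rewrite mulr_ge0.
Qed.

(** * Analysis of a path on which all confidence regions are correct *)

Section PathAnalysis.
Context {R : realType} {K : nat} {T : Type}.
Hypothesis K_ge2 : (2 <= K)%N.
Variables (A : nat -> T -> 'I_K) (Y : nat -> T -> R) (gamma : R) (mu : 'I_K -> R).
Variables (a : 'I_K) (gap : R) (x : T).
Hypothesis gamma01 : 0 < gamma < 1.
Hypothesis mu01 : gaussian_bandits mu.
Hypothesis gap_gt0 : 0 < gap.
Hypothesis gap_le : forall b, b != a -> gap <= mu a - mu b.
Hypothesis sampling : ebs_sampling A Y gamma.

Definition concentrated := forall t b, (K <= t)%N ->
  `|emp_mean A Y b t x - mu b| <= conf_radius (gamma / K%:R) (pulls A b t x).

Hypothesis conc : concentrated.

Let K_gt0 : 0 < K%:R :> R. Proof. by rewrite ltr0n (leq_trans _ K_ge2). Qed.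

Local Notation g := (gamma / K%:R).
Local Notation N b t := ((pulls A b t x)%:R : R).
Local Notation W t := (ebs_weights A Y gamma t x).

Let g_gt0 : 0 < g. Proof. by rewrite divr_gt0 //; case/andP: gamma01. Qed.

Let g_bnd : 0 < g < 4.
Proof.
rewrite g_gt0 /= ltr_pdivrMr //; have [_ g1] := andP gamma01.
have : 1 <= K%:R :> R by rewrite ler1n (leq_trans _ K_ge2).
by move=> K1; lra.
Qed.

Lemma pullsS b t : pulls A b t.+1 x = (pulls A b t x + (A t.+1 x == b))%N.
Proof. by rewrite /pulls big_nat_recr. Qed.

Lemma pulls_homo b s t : (s <= t)%N -> (pulls A b s x <= pulls A b t x)%N.
Proof.
elim: t => [|t IH]; first by rewrite leqn0 => /eqP->.
rewrite leq_eqVlt => /predU1P[->//|/IH st]; rewrite pullsS.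
exact: leq_trans st (leq_addr _ _).
Qed.

Lemma pulls_gt0 b t : (K <= t)%N -> (0 < pulls A b t x)%N.
Proof. by move=> Kt; rewrite (leq_trans _ (pulls_homo b Kt)) // (ebs_init sampling). Qed.

(* The bound of [exploration_biased_weights_ge] with [D = 1 + 2 r], where [r] is
   the bound of [conf_radius_le] on all confidence radii. *)
Definition min_weight : R := gap ^+ 2 / (2 * K%:R * (1 + 4 * Num.sqrt (4 / g)) ^+ 2).

Let D_ge1 : 1 <= 1 + 4 * Num.sqrt (4 / g).
Proof. by rewrite lerDl mulr_ge0 ?sqrtr_ge0. Qed.

Let gap_le1 : gap <= 1.
Proof.
have [b ba] := exists_other K_ge2 a; have := gap_le ba.
by case/andP: (mu01 a); case/andP: (mu01 b); lra.
Qed.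

Lemma min_weight_gt0 : 0 < min_weight.
Proof.
have := D_ge1 => D1; by rewrite divr_gt0 ?mulr_gt0 ?exprn_gt0 // (lt_le_trans _ D1).
Qed.

Lemma min_weight_le : min_weight <= K%:R^-1.
Proof.
have := D_ge1; set D := 1 + _ => D1.
have D0 : 0 < D by apply: lt_le_trans D1.
rewrite /min_weight -/D ler_pdivrMr ?mulr_gt0 ?exprn_gt0 //.
have -> : K%:R^-1 * (2 * K%:R * D ^+ 2) = 2 * D ^+ 2 by field; rewrite gt_eqF.
have : gap ^+ 2 <= D ^+ 2.
  by rewrite lerXn2r ?nnegrE ?(ltW D0) ?(ltW gap_gt0) // (le_trans gap_le1).
have : 0 <= D ^+ 2 by exact: sqr_ge0.
lra.
Qed.

Lemma conf_box t : (K <= t)%N ->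
  (forall b, conf_lo A Y gamma t x b < conf_up A Y gamma t x b) /\
  forall b, conf_lo A Y gamma t x b <= mu b <= conf_up A Y gamma t x b.
Proof.
move=> Kt; split=> b.
  rewrite /conf_lo /conf_up; have := conf_radius_gt0 g_bnd (pulls_gt0 b Kt); lra.
by rewrite /conf_lo /conf_up; have := conc b Kt; rewrite ler_distl; lra.
Qed.

Lemma ebs_weights_ge t : simplex (W t) /\ forall b, min_weight <= W t b.
Proof.
rewrite /ebs_weights; case: ltnP => Kt.
  by split=> [|b]; [exact: uniform_simplex | exact: min_weight_le].
have [lo_up in_box] := conf_box Kt.
apply: (exploration_biased_weights_ge K_ge2 (a := a) lo_up in_box gap_gt0 gap_le).
move=> b; rewrite /conf_up; have := conc a Kt; rewrite ler_distl => /andP[_].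
have := conf_radius_le g_gt0 (pulls_gt0 a Kt).
by case/andP: (mu01 a) => ? ?; case/andP: (mu01 b) => ? ?; lra.
Qed.

Local Notation S b t := (\sum_(1 <= s < t.+1) W s b).

Lemma tracking_gapS t b :
  tracking_gap A Y gamma t.+1 x b = tracking_gap A Y gamma t x b + (A t.+1 x == b)%:R - W t.+1 b.
Proof. by rewrite /tracking_gap pullsS natrD big_nat_recr //=; lra. Qed.

Lemma sum_tracking_gap t : \sum_b tracking_gap A Y gamma t x b = 0.
Proof.
elim: t => [|t IH].
  by rewrite big1 // => b _; rewrite /tracking_gap /pulls !big_nil subrr.
under eq_bigr do rewrite tracking_gapS.
rewrite sumrB big_split /= IH add0r (ebs_weights_ge t.+1).1.2.
rewrite (bigD1 (A t.+1 x)) //= eqxx big1 ?addr0 ?subrr //.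
by move=> b; rewrite eq_sym => /negbTE->.
Qed.

Lemma weights_ge0 t b : 0 <= W t b.
Proof. exact: le_trans (ltW min_weight_gt0) ((ebs_weights_ge t).2 b). Qed.

(* The tracking gaps sum to 0, so the arm that is pulled has a nonpositive gap. *)
Lemma tracking_gap_le1 t b : (K <= t)%N -> tracking_gap A Y gamma t x b <= 1.
Proof.
elim: t b => [|t IH] b; first by move=> K0; have := leq_trans K_ge2 K0.
rewrite leq_eqVlt => /predU1P[Kt|Kt].
  rewrite -Kt /tracking_gap (ebs_init sampling) lerBlDr lerDl.
  by apply: sumr_ge0 => s _; exact: weights_ge0.
rewrite tracking_gapS; have := weights_ge0 t.+1 b.
have [<-|_] := eqVneq (A t.+1 x) b; last by have := IH b Kt; rewrite /=; lra.
suff : tracking_gap A Y gamma t x (A t.+1 x) <= 0 by rewrite /=; lra.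
rewrite leNgt; apply/negP => pos.
have := sum_tracking_gap t; apply/eqP; rewrite gt_eqF //.
rewrite (bigD1 (A t.+1 x)) //= ltr_pwDl // sumr_ge0 // => c _.
by apply: le_trans (ltW pos) _; apply: (ebs_track sampling); rewrite -ltnS.
Qed.

(** The gaps sum to 0 and each of the others is at most 1, so none is below [- K]. *)
Lemma tracking t b : (K <= t)%N -> S b t - K%:R <= N b t.
Proof.
move=> Kt; suff : - K%:R <= tracking_gap A Y gamma t x b by rewrite /tracking_gap; lra.
have := sum_tracking_gap t; rewrite (bigD1 b) //=.
have : \sum_(c | c != b) tracking_gap A Y gamma t x c <= K%:R.
  apply: le_trans (_ : \sum_(c | c != b) 1 <= _).
    by apply: ler_sum => c _; exact: tracking_gap_le1.
  by rewrite sumr_const ler_nat -[leqRHS]card_ord max_card.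
lra.
Qed.

Lemma cumulated_weights_ge t b : min_weight * t%:R <= S b t.
Proof.
have -> : min_weight * t%:R = \sum_(1 <= s < t.+1) min_weight.
  by rewrite sumr_const_nat subn1 mulr_natr.
by apply: ler_sum => s _; exact: (ebs_weights_ge s).2.
Qed.

(** * Late rounds, when all confidence radii are at most [rho * gap / 4] *)

Variables (rho : R) (n0 t1 : nat).
Hypothesis rho01 : 0 < rho < 1.
Hypothesis small_radius : forall n, (n0 <= n)%N -> conf_radius g n <= rho * gap / 4.
Hypothesis K_le_t1 : (K <= t1)%N.
Hypothesis t1_large : n0%:R + K%:R <= min_weight * t1%:R.

Local Notation w := (opt_weights mu).

Let a_best b : b != a -> mu b < mu a.
Proof. by move=> /gap_le; move: gap_gt0; lra. Qed.

Let gap_ge0 b : b != a -> 0 <= mu a - mu b.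
Proof. by move=> /gap_le; apply: le_trans; exact: ltW. Qed.

Lemma late_radius_le t b : (t1 <= t)%N ->
  conf_radius g (pulls A b t x) <= rho * gap / 4.
Proof.
move=> tt; have Kt := leq_trans K_le_t1 tt; apply: small_radius.
rewrite -(ler_nat R); have := tracking b Kt; have := cumulated_weights_ge t b.
have : min_weight * t1%:R <= min_weight * t%:R.
  by rewrite ler_wpM2l ?ler_nat // ltW // min_weight_gt0.
by move: t1_large; lra.
Qed.

(** The weights played are optimal for some [nu] within [rho * gap / 2] of [mu], whose gaps are
    those of [mu] up to factors [1 - rho] and [1 + rho]. Comparing rates through [nu] takes the
    place of continuity of the optimal weights. *)
Lemma late_weights_near_optimal t : (t1 <= t)%N ->
  ((1 - rho) / (1 + rho)) ^+ 2 * info_rate mu a w <= info_rate mu a (W t).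
Proof.
move=> tt; have Kt := leq_trans K_le_t1 tt.
have [rho0 rho1] := andP rho01; have rg : 0 < rho * gap by rewrite mulr_gt0.
have [lo_up in_box] := conf_box Kt.
have [] := @exploration_biased_weights_near _ _ K_ge2 _ _ mu a lo_up in_box (rho * gap / 2).
- by move=> b ba; have := gap_le ba; nra.
- move=> b; rewrite /conf_lo; have := late_radius_le b tt; have := conc b Kt.
  by rewrite ler_distl => /andP[]; lra.
- move=> b; rewrite /conf_up; have := late_radius_le b tt; have := conc b Kt.
  by rewrite ler_distl => /andP[]; lra.
move=> nu [WE [nu_best nu_near]].
have {}WE : W t = opt_weights nu by rewrite /ebs_weights ltnNge Kt.
have nu_gap b : b != a -> (1 - rho) * (mu a - mu b) <= nu a - nu b /\
    nu a - nu b <= (1 + rho) * (mu a - mu b).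
  move=> ba; have := gap_le ba; have := nu_near a; have := nu_near b.
  rewrite !ler_distl => /andP[? ?] /andP[? ?] hg.
  have : rho * gap <= rho * (mu a - mu b) by rewrite ler_wpM2l // ltW.
  by split; lra.
have w_ge0 b : 0 <= w b by case/andP: ((opt_weights_optimal K_ge2 a_best).1.1 b).
have -> : ((1 - rho) / (1 + rho)) ^+ 2 * info_rate mu a w =
  (1 + rho)^-1 ^+ 2 * ((1 - rho) ^+ 2 * info_rate mu a w) by rewrite exprMn; ring.
apply: le_trans (_ : (1 + rho)^-1 ^+ 2 * info_rate nu a (W t) <= _).
  rewrite ler_wpM2l ?sqr_ge0 //.
  apply: le_trans (_ : info_rate nu a w <= _).
    apply: info_rate_scale => //; first by rewrite subr_ge0 ltW.
    by move=> b ba; split; [exact: gap_ge0 | exact: (nu_gap b ba).1].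
  rewrite WE; apply: (opt_weights_optimal K_ge2 nu_best).2.
  exact: (opt_weights_optimal K_ge2 a_best).1.
apply: info_rate_scale => //.
- by move=> b; exact: weights_ge0.
- by rewrite invr_ge0; lra.
- move=> b ba; split; first by rewrite subr_ge0 ltW // nu_best.
  by rewrite mulrC ler_pdivrMr ?[_ * (1 + rho)]mulrC; [exact: (nu_gap b ba).2 | lra].
Qed.

Let t_gt0 t : (t1 <= t)%N -> 0 < t%:R :> R.
Proof.
move=> tt; rewrite ltr0n (leq_trans _ tt) // (leq_trans _ K_le_t1) //.
by rewrite (leq_trans _ K_ge2).
Qed.

Lemma cumulated_weights_gt0 t b : (t1 <= t)%N -> 0 < S b t.
Proof.
move=> tt; apply: lt_le_trans (cumulated_weights_ge t b).
by rewrite mulr_gt0 ?min_weight_gt0 ?t_gt0.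
Qed.

(** By superadditivity each round after [t1] adds a near-optimal rate; what was accumulated up to
    [t1] is bounded below by 0. *)
Lemma cumulated_harm_ge t b : (t1 <= t)%N -> b != a ->
  (t%:R - t1%:R) * (((1 - rho) / (1 + rho)) ^+ 2 * info_rate mu a w) <=
  2^-1 * (harm (S a t) (S b t) * (mu a - mu b) ^+ 2).
Proof.
move=> + ba; elim: t => [|t IH] tt.
  by have := leq_trans (leq_trans K_ge2 K_le_t1) tt.
have S_ge0 c : 0 <= S c t.+1 by apply: sumr_ge0 => s _; exact: weights_ge0.
move: tt; rewrite leq_eqVlt => /predU1P[->|tt].
  rewrite subrr mul0r; apply: mulr_ge0; first by rewrite invr_ge0.
  by apply: mulr_ge0; [exact: harm_ge0 | exact: sqr_ge0].
rewrite ltnS in tt; have {}IH := IH tt.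
have Wpos c : 0 < W t.+1 c by apply: lt_le_trans min_weight_gt0 ((ebs_weights_ge t.+1).2 c).
rewrite !(@big_nat_recr _ _ _ t.+1) //=.
have := harm_superadditive (cumulated_weights_gt0 a tt) (cumulated_weights_gt0 b tt)
  (Wpos a) (Wpos b).
have := le_trans (late_weights_near_optimal (leqW tt)) (info_rate_le mu (W t.+1) ba).
set h := (_ / _) ^+ 2 * _ in IH *; set H := harm (_ + _) _ => wh hH.
have : (harm (S a t) (S b t) + harm (W t.+1 a) (W t.+1 b)) * (mu a - mu b) ^+ 2 <=
    H * (mu a - mu b) ^+ 2.
  by rewrite ler_wpM2r ?sqr_ge0.
by rewrite -natr1; lra.
Qed.

(** Three losses multiply: [(1 - rho)^2] for the empirical gap, [((1 - rho) / (1 + rho))^2] for the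
    weights, and [theta] for tracking. The last one passes through [harm] by homogeneity and
    monotonicity. *)
Lemma Zpair_ge t b : (t1 <= t)%N -> b != a -> K%:R <= min_weight * t%:R ->
  ((1 - rho) * ((1 - rho) / (1 + rho))) ^+ 2 * info_rate mu a w *
    ((1 - K%:R / (min_weight * t%:R)) * (t%:R - t1%:R)) <= Zpair A Y a b t x.
Proof.
move=> tt ba Kt'; have Kt := leq_trans K_le_t1 tt.
have [rho0 rho1] := andP rho01; have c0 := min_weight_gt0; have t0 := t_gt0 tt.
have ct0 : 0 < min_weight * t%:R by rewrite mulr_gt0.
set theta := 1 - K%:R / _.
have theta0 : 0 <= theta by rewrite /theta subr_ge0 ler_pdivrMr // mul1r.
(* The additive tracking error [K] becomes multiplicative because [S c t >= min_weight * t]. *)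
have NS c : theta * S c t <= N c t.
  apply: le_trans (tracking c Kt); rewrite /theta mulrBl mul1r lerD2l lerN2.
  rewrite -mulrA [_^-1 * _]mulrC mulrA ler_pdivlMr // ler_wpM2l ?(ltW K_gt0) //.
  exact: cumulated_weights_ge.
have Npos c : 0 < N c t by rewrite ltr0n pulls_gt0.
have hN : theta * harm (S a t) (S b t) <= harm (N a t) (N b t).
  have [th0|th0] := eqVneq theta 0; first by rewrite th0 mul0r harm_ge0 ?ltW.
  rewrite -harmZ //; apply: harm_homo => //; rewrite mulr_gt0 ?cumulated_weights_gt0 //;
  by rewrite lt_neqAle eq_sym th0.
set d := emp_mean A Y a t x - emp_mean A Y b t x.
have dge : (1 - rho) * (mu a - mu b) <= d.
  rewrite /d; have := conc a Kt; have := conc b Kt.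
  have := late_radius_le a tt; have := late_radius_le b tt; have := gap_le ba => hg.
  rewrite !ler_distl => r1 r2 /andP[? ?] /andP[? ?].
  have : rho * gap <= rho * (mu a - mu b) by rewrite ler_wpM2l // ltW.
  by lra.
have d0 : 0 <= (1 - rho) * (mu a - mu b) by rewrite mulr_ge0 ?gap_ge0 // subr_ge0 ltW.
rewrite /Zpair -/d -/(harm _ _) ger0_norm ?(le_trans d0) // -[leRHS]mulrA -[d * d]expr2.
have d2 : ((1 - rho) * (mu a - mu b)) ^+ 2 <= d ^+ 2.
  by rewrite lerXn2r ?nnegrE // (le_trans d0).
have := cumulated_harm_ge tt ba; set H := harm (S a t) (S b t) in hN *.
have H0 : 0 <= H by rewrite harm_ge0 // ltW // cumulated_weights_gt0.
set h := (_ / _) ^+ 2 * _ => hH.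
apply: le_trans (_ : 2^-1 * (theta * H) * ((1 - rho) * (mu a - mu b)) ^+ 2 <= _); last first.
  have thH : 0 <= theta * H by exact: mulr_ge0.
  apply: ler_pM => //; [by rewrite mulr_ge0 ?invr_ge0 | exact: sqr_ge0 |].
  by rewrite ler_pM2l ?invr_gt0.
have -> : 2^-1 * (theta * H) * ((1 - rho) * (mu a - mu b)) ^+ 2 =
  (1 - rho) ^+ 2 * theta * (2^-1 * (H * (mu a - mu b) ^+ 2)) by ring.
apply: le_trans (_ : (1 - rho) ^+ 2 * theta * ((t%:R - t1%:R) * h) <= _).
  by rewrite /h exprMn le_eqVlt; apply/orP; left; apply/eqP; ring.
by rewrite ler_wpM2l // mulr_ge0 ?sqr_ge0.
Qed.

Lemma Zstat_ge t : (t1 <= t)%N -> K%:R / min_weight + t1%:R <= t%:R ->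
  (1 - 6 * rho) / Tchar mu * (t%:R - (K%:R / min_weight + t1%:R)) <= Zstat A Y t x.
Proof.
move=> tt tB; have [rho0 rho1] := andP rho01; have c0 := min_weight_gt0; have t0 := t_gt0 tt.
have T0 : 0 < Tchar mu := Tchar_gt0 K_ge2 mu01 a_best.
have invT := inv_Tchar_le K_ge2 mu01 a_best.
have iT0 : 0 < (Tchar mu)^-1 by rewrite invr_gt0.
have B0 : 0 <= K%:R / min_weight by rewrite divr_ge0 ?ltW.
set B := K%:R / min_weight + t1%:R in tB *.
have ct : K%:R <= min_weight * t%:R.
  by rewrite -ler_pdivrMl // mulrC (le_trans _ tB) // lerDl.
apply: le_trans (_ : fmin (fun b => b != a) (fun b => Zpair A Y a b t x) <= _); last first.
  exact: (@fmax_ge _ _ predT (fun c => fmin (fun b => b != c) (fun b => Zpair A Y c b t x))).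
have [b0 b0a] := exists_other K_ge2 a.
apply: (@fmin_ge _ _ (fun b => b != a) _ _ b0 b0a) => b ba.
apply: le_trans (Zpair_ge tt ba ct).
(* To first order the loss is [4 rho] from the numerator plus [2 rho] from the denominator; the
   remainder is nonnegative. *)
have qge : 1 - 6 * rho <= ((1 - rho) * ((1 - rho) / (1 + rho))) ^+ 2.
  have -> : ((1 - rho) * ((1 - rho) / (1 + rho))) ^+ 2 = (1 - rho) ^+ 4 / (1 + rho) ^+ 2.
    by field; rewrite gt_eqF // addr_gt0.
  rewrite ler_pdivlMr ?exprn_gt0 ?addr_gt0 // -subr_ge0.
  have -> : (1 - rho) ^+ 4 - (1 - 6 * rho) * (1 + rho) ^+ 2 =
    rho ^+ 2 * (17 + 2 * rho + rho ^+ 2) by ring.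
  by rewrite mulr_ge0 ?sqr_ge0 // !addr_ge0 ?sqr_ge0 ?mulr_ge0 // ltW.
have tge : t%:R - B <= (1 - K%:R / (min_weight * t%:R)) * (t%:R - t1%:R).
  have -> : (1 - K%:R / (min_weight * t%:R)) * (t%:R - t1%:R) =
    t%:R - B + K%:R * t1%:R / (min_weight * t%:R).
    by rewrite /B; field; rewrite !gt_eqF.
  by rewrite lerDl divr_ge0 ?mulr_ge0 // ltW // mulr_gt0.
have tB0 : 0 <= t%:R - B by rewrite subr_ge0.
set q := (_ * _) ^+ 2 in qge *.
have q0 : 0 <= q by exact: sqr_ge0.
apply: le_trans (_ : q * (Tchar mu)^-1 * (t%:R - B) <= _).
  by rewrite ler_wpM2r // ler_wpM2r // ltW.
apply: ler_pM => //; first by rewrite mulr_ge0 // ltW.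
by rewrite ler_wpM2l.
Qed.

End PathAnalysis.

(** * Deterministic bound on the stopping time *)

Lemma stop_time_le (R : realType) (K : nat) (gamma alpha eta c : R) (mu : 'I_K -> R) :
  (2 <= K)%N -> 0 < gamma < 1 -> 1 <= alpha <= 2 -> 0 < eta <= 1 -> 0 < c ->
  unique_best_bandits mu ->
  exists L0 : R, 0 < L0 /\
  forall (T : Type) (A : nat -> T -> 'I_K) (Y : nat -> T -> R) (x : T),
  ebs_sampling A Y gamma -> concentrated A Y gamma mu x ->
  forall delta, 0 < delta -> L0 <= ln (1 / delta) ->
  (stop_time A Y (log_threshold c alpha delta) x <=
   ((1 + eta) * Tchar mu * ln (1 / delta))%:E)%E.
Proof.
move=> K2 gamma01 /andP[alpha1 alpha2] /andP[eta0 eta1] c0 [mu01 some].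
case E : (best_arm mu) some => [a|//] _; have a_best := best_arm_max E.
have K0 : 0 < K%:R :> R by rewrite ltr0n (leq_trans _ K2).
have [gap [gap0 gap_le]] := exists_gap K2 a_best.
have T0 : 0 < Tchar mu := Tchar_gt0 K2 mu01 a_best.
have g0 : 0 < gamma / K%:R by rewrite divr_gt0 //; case/andP: gamma01.
(* This makes the slope loss [6 * rho] equal to [eta / 6]. *)
pose rho := eta / 36.
have rho01 : 0 < rho < 1 by rewrite /rho; lra.
have e0 : 0 < rho * gap / 4 by rewrite divr_gt0 // mulr_gt0 //; case/andP: rho01.
have [n0 hn0] := conf_radius_cvg0 g0 e0.
pose w0 := @min_weight R K gamma gap.
have w0_gt0 : 0 < w0 := min_weight_gt0 K2 gamma gap0.
pose t1 := (K + Num.bound ((n0%:R + K%:R) / w0))%N.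
have t1_large : n0%:R + K%:R <= w0 * t1%:R.
  rewrite -ler_pdivrMl // mulrC natrD; apply: ltW.
  have := archi_boundP (_ : 0 <= (n0%:R + K%:R) / w0).
  by rewrite divr_ge0 ?addr_ge0 ?(ltW w0_gt0) // => /(_ isT); have := K0; lra.
have K_le_t1 : (K <= t1)%N by exact: leq_addr.
pose B := K%:R / w0 + t1%:R.
have k0 : 0 < eta / (6 * Tchar mu) by rewrite divr_gt0 // mulr_gt0.
(* A share [eta / 6] of [t / T(mu)] pays for [alpha ln t], [ln c] and the offset [B]. *)
have [n1 hn1] := eventually_ln_lt (ln c + B / Tchar mu) k0.
pose T1 : R := B + n1%:R.
have B0 : 0 <= B by rewrite addr_ge0 // divr_ge0 ?ltW.
have T10 : 0 <= T1 by rewrite addr_ge0.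
(* The three terms ensure [L >= 1], [T(mu) L >= T1], and [eta T(mu) L >= 2]; the last absorbs
   rounding [t] to an integer. None depends on the path or on the sample space. *)
exists (1 + T1 / Tchar mu + 2 / (eta * Tchar mu)); split.
  have h1 : 0 <= T1 / Tchar mu by rewrite divr_ge0 // ltW.
  have h2 : 0 <= 2 / (eta * Tchar mu) by rewrite divr_ge0 // mulr_ge0 // ltW.
  lra.
move=> T A Y x sampling conc delta delta0; set L := ln (1 / delta) => L0L.
have h1 : 0 <= T1 / Tchar mu by rewrite divr_ge0 // ltW.
have h2 : 0 <= 2 / (eta * Tchar mu) by rewrite divr_ge0 // mulr_ge0 // ltW.
have L1 : 1 <= L by lra.
have TL1 : T1 <= Tchar mu * L by rewrite -ler_pdivrMl // mulrC; lra.
have TL2 : 2 <= eta * (Tchar mu * L).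
  by rewrite mulrA -ler_pdivrMl ?mulr_gt0 // mulrC; lra.
have TL0 : 0 < Tchar mu * L by rewrite mulr_gt0 //; lra.
pose t := (Num.truncn ((1 + eta / 2) * (Tchar mu * L))).+1.
have t_gt : (1 + eta / 2) * (Tchar mu * L) < t%:R by exact: truncnS_gt.
have t_le : t%:R <= (1 + eta / 2) * (Tchar mu * L) + 1.
  by rewrite /t -[leLHS]natr1 lerD2r truncn_le // mulr_ge0 ?(ltW TL0) //; lra.
apply: (@le_trans _ _ t%:R%:E); last first.
  by rewrite lee_fin -mulrA; nra.
have tT1 : T1 <= t%:R.
  apply: le_trans TL1 (le_trans _ (ltW t_gt)); rewrite ler_peMl ?(ltW TL0) //; lra.
have tB : B <= t%:R by apply: le_trans tT1; rewrite lerDl.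
have t1t : (t1 <= t)%N.
  by rewrite -(ler_nat R); apply: le_trans tB; rewrite lerDr divr_ge0 // ltW.
have n1t : (n1 <= t)%N by rewrite -(ler_nat R); apply: le_trans tT1; rewrite lerDr.
apply: ereal_inf_lbound; exists t => //; split; first exact: leq_trans K_le_t1 t1t.
apply: lt_le_trans (Zstat_ge K2 gamma01 mu01 gap0 gap_le sampling conc rho01 hn0
  K_le_t1 t1_large t1t tB).
have tpos : 0 < t%:R :> R by rewrite ltr0n.
rewrite /log_threshold lnM ?posrE ?mulr_gt0 ?powR_gt0 ?invr_gt0 //.
rewrite lnM ?posrE ?powR_gt0 // ln_powR -[delta^-1]mul1r -/L.
have lnt : alpha * ln t%:R <= 2 * ln t%:R.
  by rewrite ler_wpM2r // ln_ge0 // ler1n.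
have := hn1 _ n1t; rewrite -/w0 -/B.
have kE : eta / (6 * Tchar mu) * t%:R = eta / 6 * (t%:R / Tchar mu) by field; rewrite gt_eqF.
have qE : (1 - 6 * rho) / Tchar mu * (t%:R - B) =
    (1 - eta / 6) * (t%:R / Tchar mu) - (1 - eta / 6) * (B / Tchar mu).
  by rewrite /rho; field; rewrite gt_eqF.
rewrite kE qE.
have BT : 0 <= B / Tchar mu by rewrite divr_ge0 // ltW.
(* [(1 - eta / 3) (1 + eta / 2) >= 1] for [eta <= 1]. With the share [eta / 6] of the logarithm, the
   total is the slope [1 - eta / 6]. *)
have Lt : L <= (1 - eta / 3) * (t%:R / Tchar mu).
  have : (1 + eta / 2) * L < t%:R / Tchar mu.
    by rewrite ltr_pdivlMr // -mulrA [L * _]mulrC.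
  set u := t%:R / _ => hu.
  have u0 : 0 < u by rewrite divr_gt0.
  have : (1 - eta / 3) * ((1 + eta / 2) * L) <= (1 - eta / 3) * u.
    by rewrite ler_wpM2l ?(ltW hu) //; lra.
  apply: le_trans; rewrite mulrA ler_peMl //; [lra | nra].
have : eta / 6 * (B / Tchar mu) >= 0 by rewrite mulr_ge0 // divr_ge0 // ltW.
set u := t%:R / _ in Lt *; set v := B / _.
move=> *; lra.
Qed.

(** * Exponential supermartingales *)

Section GaussianTilt.
Import HBNNSimple.
Context {R : realType}.
Local Open Scope ereal_scope.
Local Notation leb := (@lebesgue_measure R).

(** The density of [N(m + l, 1)] with respect to [N(m, 1)]. *)
Definition tilt (m l y : R) : R := expR (l * (y - m) - l ^+ 2 / 2).

Lemma measurable_tilt (m l : R) : measurable_fun setT (tilt m l).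
Proof.
apply: measurableT_comp => //; apply: measurable_funB => //.
by apply: measurable_funM => //; exact: measurable_funB.
Qed.

Lemma tilt_normal_pdf (m l y : R) :
  (tilt m l y * normal_pdf m 1 y = normal_pdf (m + l) 1 y)%R.
Proof.
rewrite /normal_pdf oner_eq0 /normal_fun mulrCA -expRD; congr (_ * expR _)%R.
by rewrite expr1n; field.
Qed.

Lemma integral_normal_prob (m s : R) (f : R -> \bar R) :
  (normal_prob m s).-integrable setT f ->
  \int[normal_prob m s]_y f y = \int[leb]_y (f y * (normal_pdf m s y)%:E).
Proof.
move=> intf; have mf := measurable_int _ intf.
rewrite -(Radon_Nikodym_change_of_variables (normal_prob_dominates m s)) //=.
apply: ae_eq_integral => //.
- apply: emeasurable_funM => //; apply: (measurable_int leb).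
  by apply: Radon_Nikodym_integrable; exact: normal_prob_dominates.
- apply: emeasurable_funM => //; apply/measurable_EFinP; exact: measurable_normal_pdf.
- apply: ae_eqe_mul2l => /=; rewrite Radon_NikodymE //=; first exact: normal_prob_dominates.
  move=> dom; case: cid => /= h [h1 h2 h3]; apply: integral_ae_eq => //=.
  + by apply/measurable_EFinP; exact: measurable_normal_pdf.
  + by move=> E _ mE; rewrite -h3.
Qed.

(** The change of density is applied to the simple functions below [tilt], which are bounded, hence
    integrable. After it, each lies below the density of [N(m + l, 1)]. *)
Lemma integral_tilt_le1 (m l : R) : \int[normal_prob m 1]_y (tilt m l y)%:E <= 1.
Proof.
rewrite ge0_integralTE; last by move=> y; rewrite lee_fin expR_ge0.
apply: ge_ereal_sup => _ [g /= gh <-].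
rewrite -integralT_nnsfun integral_normal_prob; last first.
  apply: (@measurable_bounded_integrable _ _ _ (normal_prob m 1) g) => //.
  - by apply: (@le_lt_trans _ _ 1); [exact: probability_le1 | exact: ltry].
  - exact: simple_bounded.
rewrite -[leRHS](integral_normal_pdf (m + l) 1); apply: ge0_le_integral => //.
- by move=> y _; rewrite mule_ge0 // lee_fin ?fun_ge0 // normal_pdf_ge0.
- apply: emeasurable_funM; first exact/measurable_EFinP.
  by apply/measurable_EFinP; exact: measurable_normal_pdf.
- by apply/measurable_EFinP; exact: measurable_normal_pdf.
- move=> y _; rewrite -EFinM lee_fin -tilt_normal_pdf ler_wpM2r ?normal_pdf_ge0 //.
  by rewrite -lee_fin; exact: gh.
Qed.

End GaussianTilt.

(** * Integration of products under independence on an event *)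

Section RestrictedMeasure.
Local Open Scope ereal_scope.
Context d (T : measurableType d) (R : realType) (mu : {measure set T -> \bar R}).

(** On subsets of [D], [mu] is the sum of its restrictions to [D] and to its complement; the second
    does not charge [D], nor the first the complement. *)
Lemma ge0_integral_mrestr (D : set T) (mD : measurable D) (f : T -> \bar R) :
  measurable_fun setT f -> (forall x, 0 <= f x) ->
  \int[mrestr mu mD]_x f x = \int[mu]_(x in D) f x.
Proof.
move=> mf f0; pose mrC := mrestr mu (measurableC mD).
have mfD : measurable_fun D f by exact: measurable_funS mf.
rewrite (eq_measure_integral (measure_add (mrestr mu mD) mrC)); last first.
  move=> A mA AD; apply: etrans (esym (measure_addE _ _ _)); rewrite /mrC /= /mrestr.
  rewrite (setIidl AD) (_ : A `&` ~` D = set0) ?measure0 ?adde0 //.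
  by rewrite -subset0 => x [/AD].
rewrite ge0_integral_measure_add //.
rewrite (@null_set_integral _ _ _ mrC) ?adde0 //; last first.
  by rewrite /mrC /= /mrestr setICr measure0.
rewrite (@ge0_negligible_integral _ _ _ _ setT (~` D)) //; last 2 first.
- exact: measurableC.
- by rewrite /= /mrestr setICl measure0.
by rewrite setTD setCK.
Qed.

End RestrictedMeasure.

Section ImageMeasure.
Local Open Scope ereal_scope.
Context d d' (T : measurableType d) (T' : measurableType d') (R : realType).
Variables (m : {finite_measure set T -> \bar R}) (f : T -> T').

(* The measurability proof is an argument so that the measure structure can be
   inferred from the term. *)
Definition image_measure (mf : measurable_fun setT f) : set T' -> \bar R :=
  pushforward m f.

Hypothesis mf : measurable_fun setT f.

Let measurable_image_pre (B : set T') : measurable B -> measurable (f @^-1` B).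
Proof. by move=> mB; rewrite -[X in measurable X]setTI; exact: mf. Qed.

Let image_measure0 : image_measure mf set0 = 0.
Proof. by rewrite /image_measure /pushforward preimage_set0 measure0. Qed.

Let image_measure_ge0 B : 0 <= image_measure mf B.
Proof. exact: measure_ge0. Qed.

Let image_measure_sigma_additive : semi_sigma_additive (image_measure mf).
Proof.
move=> F mF tF mUF; rewrite /image_measure /pushforward preimage_bigcup.
apply: measure_semi_sigma_additive; first by move=> n; exact: measurable_image_pre.
- apply/trivIsetP => /= i j _ _ ij; rewrite -preimage_setI.
  by move/trivIsetP : tF => /(_ _ _ _ _ ij) ->//; rewrite preimage_set0.
- by rewrite -preimage_bigcup; exact: measurable_image_pre.
Qed.

HB.instance Definition _ := isMeasure.Build _ _ _ (image_measure mf)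
  image_measure0 image_measure_ge0 image_measure_sigma_additive.

Let image_measure_fin : fin_num_fun (image_measure mf).
Proof.
by move=> B mB; apply: fin_num_measure; exact: measurable_image_pre.
Qed.

HB.instance Definition _ := Measure_isFinite.Build _ _ _ (image_measure mf)
  image_measure_fin.

End ImageMeasure.

(** Under [P] restricted to [D], the joint law of [Phi] and [Y] agrees with a product measure on
    rectangles, hence everywhere, and Tonelli applies. *)
Lemma integral_independent_mul d d' (T : measurableType d) (T' : measurableType d')
    (R : realType) (P : probability T R) (D : set T) (mD : measurable D)
    (Q : probability T' R) (Phi : T -> R) (Y : T -> T') (h : T' -> R) :
  measurable_fun setT Phi -> measurable_fun setT Y -> measurable_fun setT h ->
  (forall x, 0 <= Phi x) -> (forall y, 0 <= h y) ->
  (forall (B : set R) (C : set T'), measurable B -> measurable C ->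
    P (Phi @^-1` B `&` D `&` Y @^-1` C) = (P (Phi @^-1` B `&` D) * Q C)%E) ->
  (\int[P]_(x in D) (Phi x * h (Y x))%:E =
   \int[P]_(x in D) (Phi x)%:E * \int[Q]_y (h y)%:E)%E.
Proof.
move=> mPhi mY mh Phi0 h0 indep.
have PD : (P D < +oo)%E by rewrite (le_lt_trans (probability_le1 _ mD)) ?ltry.
pose PmD : {finite_measure set T -> \bar R} := mfrestr mD PD.
have mPY := measurable_fun_pair mPhi mY.
pose law : {measure set (R * T') -> \bar R} := image_measure PmD mPY.
pose law1 : {finite_measure set R -> \bar R} := image_measure PmD mPhi.
(* The absolute value makes the integrand nonnegative on the whole product space, not just on the
   range of [Phi]. *)
pose F (p : R * T') := (`|p.1| * h p.2)%:E.
have mF : measurable_fun setT F.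
  apply/measurable_EFinP; apply: measurable_funM.
    by apply: measurableT_comp => //; exact: measurable_fst.
  by apply: (measurableT_comp mh); exact: measurable_snd.
have F0 p : (0 <= F p)%E by rewrite lee_fin mulr_ge0.
have mPhiE : measurable_fun setT (fun x => (Phi x)%:E) by exact/measurable_EFinP.
transitivity (\int[law]_p F p)%E.
  rewrite (@ge0_integral_pushforward _ _ _ _ _ _ mPY PmD setT F) //.
  rewrite preimage_setT.
  rewrite (ge0_integral_mrestr P mD (measurableT_comp mF mPY) (fun x => F0 _)).
  by apply: eq_integral => x _; rewrite /F /= ger0_norm.
transitivity (\int[law1 \x Q]_p F p)%E.
  apply: (eq_measure_integral (law1 \x Q)%E) => X mX _; apply/esym.
  apply: (@product_measure_unique _ _ _ _ _ law1 Q law) => // B C mB mC.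
  rewrite /law /law1 /image_measure /pushforward /PmD /mfrestr /mrestr /= -indep //.
  by congr (P _); apply/seteqP; split => x /= => [[[]]|[[]]].
rewrite fubini_tonelli1 //.
transitivity (\int[law1]_u (`|u|%:E * \int[Q]_y (h y)%:E))%E.
  apply: eq_integral => u _; rewrite /fubini_F /F.
  under eq_integral do rewrite /= EFinM.
  rewrite ge0_integralZl //; first exact/measurable_EFinP.
  by move=> y _; rewrite lee_fin.
have mnorm : measurable_fun setT (fun u : R => `|u|%:E).
  by apply/measurable_EFinP; exact: normr_measurable.
rewrite ge0_integralZr //; last by apply: integral_ge0 => y _; rewrite lee_fin.
congr (_ * _)%E; rewrite (@ge0_integral_pushforward _ _ _ _ _ _ mPhi PmD) //.
rewrite preimage_setT (ge0_integral_mrestr P mD (measurableT_comp mnorm mPhi)).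
  by apply: eq_integral => x _; rewrite /= ger0_norm.
by move=> x; rewrite lee_fin.
Qed.

(** * The exponential supermartingale of one arm *)

Section Concentration.
Context {R : realType} {K : nat} {d : measure_display} {T : measurableType d}.
Context {P : probability T R}.
Variables (mu : 'I_K -> R) (A : nat -> T -> 'I_K) (Y : nat -> {RV P >-> R}).
Hypothesis run : bandit_run mu A Y.

Local Notation past := (past A Y).

(** By strong induction on time: the arm of round [s + 1] is determined by the past up to [s], and
    rewards are random variables. *)
Lemma past_measurable t (E : set T) : past t E -> measurable E.
Proof.
elim/ltn_ind: t E => t IH; apply: smallest_sub; first exact: sigma_algebra_measurable.
move=> _ [s [/andP[s0 st] [[a ->]|[B mB ->]]]].
  by case: s s0 st => // s _ st; apply: (IH s st); exact: (run_arm run).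
by rewrite -[X in measurable X]setTI; apply: measurable_funPT.
Qed.

Lemma past_homo s t : (s <= t)%N -> past s `<=` past t.
Proof.
move=> st; apply: sub_sigma_algebra2 => E [u [/andP[u0 us] H]].
by exists u; rewrite u0 (leq_trans us st).
Qed.

Definition adapted d' (U : measurableType d') (t : nat) (f : T -> U) :=
  forall B, measurable B -> past t (f @^-1` B).

Local Notation pastT t := (g_sigma_algebraType
  [set E : set T | exists s, (1 <= s <= t)%N /\
     ((exists a, E = A s @^-1` [set a]) \/
      (exists2 B : set R, measurable B & E = Y s @^-1` B))]).

Lemma adaptedP d' (U : measurableType d') t (f : T -> U) :
  adapted t f <-> measurable_fun (setT : set (pastT t)) (f : pastT t -> U).
Proof.
split=> [af _ B mB|mf B mB]; first by rewrite setTI; exact: af.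
by have := mf measurableT B mB; rewrite setTI.
Qed.

Lemma adapted_measurable d' (U : measurableType d') t (f : T -> U) :
  adapted t f -> measurable_fun setT f.
Proof. by move=> af _ B mB; rewrite setTI; apply: past_measurable; exact: af. Qed.

Lemma adapted_homo d' (U : measurableType d') s t (f : T -> U) : (s <= t)%N ->
  adapted s f -> adapted t f.
Proof. by move=> st af B mB; apply: past_homo st _ _; exact: af. Qed.

Lemma arm_in_past t a : (0 < t)%N -> past t (A t @^-1` [set a]).
Proof.
move=> t0; apply: sub_sigma_algebra; exists t; rewrite t0 leqnn.
by split=> //; left; exists a.
Qed.

Lemma adapted_arm a t : (0 < t)%N -> adapted t (fun x => A t x == a).
Proof.
move=> t0; apply/adaptedP; apply: (measurable_fun_bool true); rewrite setTI.
rewrite (_ : _ @^-1` _ = A t @^-1` [set a]); first exact: arm_in_past.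
by apply/seteqP; split=> x /= /eqP.
Qed.

Lemma adapted_pulls a t : adapted t (fun x => (pulls A a t x)%:R : R).
Proof.
elim: t => [|t IH].
  apply/adaptedP; rewrite (_ : (fun x => _) = (fun=> 0)); first exact: measurable_cst.
  by apply/funext => x; rewrite /pulls big_nil.
rewrite (_ : (fun x => _) = (fun x => (pulls A a t x)%:R + (if A t.+1 x == a then 1 else 0))).
  apply/adaptedP; apply: measurable_funD; first by apply/adaptedP; exact: adapted_homo IH.
  by apply: measurable_fun_ifT => //; apply/adaptedP; exact: adapted_arm.
by apply/funext => x; rewrite pullsS natrD; case: (_ == _).
Qed.

Lemma measurable_many_pulls a t n : measurable [set x | (n <= pulls A a t x)%N].
Proof.
rewrite (_ : [set x | _] = (fun x => (pulls A a t x)%:R : R) @^-1` `[n%:R, +oo[%classic).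
  by apply: past_measurable; apply: adapted_pulls; exact: measurable_itv.
by apply/seteqP; split=> x; rewrite /= in_itv /= andbT ler_nat.
Qed.

Lemma few_pulls_in_past a n t : past t [set x | (pulls A a t x < n)%N].
Proof.
rewrite (_ : [set x | _] = (fun x => (pulls A a t x)%:R : R) @^-1` `]-oo, n%:R[%classic).
  by apply: adapted_pulls; exact: measurable_itv.
by apply/seteqP; split=> x; rewrite /= in_itv /= ltr_nat.
Qed.

Variables (a : 'I_K) (n : nat) (l : R).

Definition gate t x := (A t.+1 x == a) && (pulls A a t x < n)%N.

(* [exp (l S - l^2 / 2 k)], where [S] is the sum of the centered rewards of the
   first [k = min n (pulls a t)] pulls of [a]. *)
Fixpoint exp_martingale t x : R := if t is t'.+1 then
    (if gate t' x then exp_martingale t' x * tilt (mu a) l (Y t x) else exp_martingale t' x)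
  else 1.

Lemma exp_martingale_ge0 t x : 0 <= exp_martingale t x.
Proof. by elim: t => //= t IH; case: ifP => _ //; rewrite mulr_ge0 ?expR_ge0. Qed.

Lemma gateE t : [set x | gate t x] =
  [set x | (pulls A a t x < n)%N] `&` A t.+1 @^-1` [set a].
Proof.
apply/seteqP; split=> x; rewrite /= /gate; first by case/andP => /eqP.
by case=> px ->; rewrite eqxx.
Qed.

Lemma gate_in_past t : past t [set x | gate t x].
Proof.
rewrite gateE; apply: (@measurableI _ (pastT t)); first exact: few_pulls_in_past.
exact: (run_arm run).
Qed.

Lemma adapted_exp_martingale t : adapted t (exp_martingale t).
Proof.
elim: t => [|t IH]; first by apply/adaptedP; exact: measurable_cst.
apply/adaptedP => /=; have IHm := adapted_homo (leqnSn t) IH.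
apply: measurable_fun_ifT.
- apply: (measurable_fun_bool true); rewrite setTI.
  by apply: past_homo (leqnSn t) _ _; exact: gate_in_past.
- apply: measurable_funM; first exact/adaptedP.
  apply: measurableT_comp; first exact: measurable_tilt.
  apply/adaptedP => B mB; apply: sub_sigma_algebra; exists t.+1; rewrite leqnn.
  by split=> //; right; exists B.
- exact/adaptedP.
Qed.

Lemma measurable_exp_martingale_ge t c : measurable [set x | c <= exp_martingale t x].
Proof.
rewrite (_ : [set x | _] = exp_martingale t @^-1` `[c, +oo[%classic).
  by apply: past_measurable; apply: adapted_exp_martingale; exact: measurable_itv.
by apply/seteqP; split=> x; rewrite /= in_itv /= andbT.
Qed.

Local Open Scope ereal_scope.

(** The gate event belongs to the past. On it the new factor is a tilt of a fresh [N(mu a, 1)]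
    reward, of integral at most 1; off it nothing changes. *)
Lemma exp_martingale_le1 t : \int[P]_x (exp_martingale t x)%:E <= 1.
Proof.
elim: t => [|t IH].
  by rewrite /= integral_cst // mul1e probability_le1.
apply: le_trans IH; pose D := [set x | gate t x].
have mD : measurable D by apply: past_measurable; exact: gate_in_past.
have mE s : measurable_fun setT (fun x => (exp_martingale s x)%:E).
  by apply/measurable_EFinP; apply: adapted_measurable; exact: adapted_exp_martingale.
have E0 s x : 0 <= (exp_martingale s x)%:E by rewrite lee_fin exp_martingale_ge0.
have split_D s : \int[P]_x (exp_martingale s x)%:E =
    \int[P]_(x in D) (exp_martingale s x)%:E + \int[P]_(x in ~` D) (exp_martingale s x)%:E.
  rewrite -ge0_integral_setU ?setUv //; first exact: measurableC.
  by apply/eqP; exact: setICr.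
rewrite !split_D; apply: leeD; last first.
  rewrite le_eqVlt; apply/orP; left; apply/eqP; apply: eq_integral => x.
  by rewrite inE /D /= => /negP/negbTE->.
have -> : \int[P]_(x in D) (exp_martingale t.+1 x)%:E =
    \int[P]_(x in D) (exp_martingale t x * tilt (mu a) l (Y t.+1 x))%:E.
  by apply: eq_integral => x; rewrite inE /D /= => ->.
rewrite (integral_independent_mul mD (Q := normal_prob (mu a) 1)) //.
- rewrite -[leRHS]mule1; apply: lee_wpmul2l; last exact: integral_tilt_le1.
  by apply: integral_ge0 => x _; exact: E0.
- by apply: adapted_measurable; exact: adapted_exp_martingale.
- move=> _ C mC; rewrite setTI; apply: past_measurable (_ : past t.+1 _).
  apply: sub_sigma_algebra; exists t.+1; rewrite leqnn; split=> //; right.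
  by exists C.
- exact: measurable_tilt.
- exact: exp_martingale_ge0.
- by move=> y; exact: expR_ge0.
- move=> B C mB mC; rewrite /D gateE !setIA; apply: (run_reward run) => //.
  apply: (@measurableI _ (pastT t)); last exact: few_pulls_in_past.
  exact: adapted_exp_martingale.
Qed.

(** Markov's inequality. *)
Lemma exp_martingale_tail t (c : R) : (0 < c)%R ->
  P [set x | (c <= exp_martingale t x)%R] <= (c^-1)%:E.
Proof.
move=> c0; set S := [set x | _].
have mM : measurable_fun setT (exp_martingale t).
  by apply: adapted_measurable; exact: adapted_exp_martingale.
have mS : measurable S by exact: measurable_exp_martingale_ge.
have : c%:E * P S <= 1.
  apply: le_trans (exp_martingale_le1 t).
  rewrite -(integral_cst P mS).
  apply: le_trans (_ : \int[P]_(x in S) (exp_martingale t x)%:E <= _).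
    apply: ge0_le_integral => //; first by move=> x _; rewrite lee_fin ltW.
    by apply/measurable_EFinP; exact: measurable_funS mM.
  apply: ge0_subset_integral => //; first exact/measurable_EFinP.
  by move=> x _; rewrite lee_fin exp_martingale_ge0.
by rewrite -lee_pdivlMl // mule1.
Qed.

End Concentration.

(** * Union bound over arms and numbers of pulls *)

Lemma sum_inv_sqr_le2 (R : realType) t : \sum_(1 <= n < t.+1) (n%:R ^+ 2)^-1 <= 2 :> R.
Proof.
(* Telescoping invariant: [1 / n^2 <= 2 / n - 2 / (n + 1)] for [n >= 1]. *)
suff : \sum_(1 <= n < t.+1) (n%:R ^+ 2)^-1 <= 2 - 2 * t.+1%:R^-1 :> R.
  by move/le_trans; apply; rewrite gerBl mulr_ge0 // invr_ge0.
elim: t => [|t IH]; first by rewrite big_nil invr1; lra.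
rewrite big_nat_recr //=; apply: le_trans (lerD IH (lexx _)) _.
have t0 : 0 <= t%:R :> R by [].
rewrite -[t.+2%:R]natr1 -[t.+1%:R]natr1 -subr_ge0.
set u := t%:R + 1; have u1 : 1 <= u by rewrite /u lerDr.
have -> : 2 - 2 * (u + 1)^-1 - (2 - 2 * u^-1 + (u ^+ 2)^-1) = (u - 1) / (u ^+ 2 * (u + 1)).
  by field; rewrite !gt_eqF //; lra.
by rewrite divr_ge0 ?mulr_ge0 ?sqr_ge0 ?subr_ge0 //; lra.
Qed.

(** The radius satisfies [n C^2 / 2 = 2 ln (4 n / g)], so the failure probability [(g / (4 n))^2] is
    summable over [n]. *)
Lemma expR_conf_radius (R : realType) (g : R) (n : nat) : 0 < g < 4 -> (0 < n)%N ->
  (expR (n%:R * conf_radius g n ^+ 2 / 2))^-1 = g ^+ 2 / 16 * (n%:R ^+ 2)^-1.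
Proof.
move=> /andP[g0 g4] n0; have nR : 1 <= n%:R :> R by rewrite ler1n.
have n_gt0 : 0 < n%:R :> R by rewrite ltr0n.
have ln0 : 0 <= ln (4 * n%:R / g).
  by apply: ln_ge0; rewrite ler_pdivlMr //; nra.
rewrite /conf_radius exprMn sqr_sqrtr ?divr_ge0 ?(ltW n_gt0) //.
have -> : n%:R * (2 ^+ 2 * (ln (4 * n%:R / g) / n%:R)) / 2 =
    ln (4 * n%:R / g) + ln (4 * n%:R / g).
  by field; rewrite gt_eqF.
rewrite expRD lnK ?posrE ?divr_gt0 ?mulr_gt0 //.
by field; rewrite !gt_eqF.
Qed.

Section ConcentrationEvent.
Context {R : realType} {K : nat} {d : measure_display} {T : measurableType d}.
Context {P : probability T R}.
Variables (mu : 'I_K -> R) (A : nat -> T -> 'I_K) (Y : nat -> {RV P >-> R}).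
Variable gamma : R.
Hypothesis K_ge2 : (2 <= K)%N.
Hypothesis gamma01 : 0 < gamma < 1.
Hypothesis run : bandit_run mu A Y.
Hypothesis sampling : ebs_sampling A Y gamma.

Local Notation g := (gamma / K%:R).
Local Notation C n := (conf_radius g n).
Local Notation M a n l := (exp_martingale mu A Y a n l).

Lemma exp_martingaleE a n l t x : (pulls A a t x <= n)%N ->
  M a n l t x = expR (l * (\sum_(1 <= s < t.+1 | A s x == a) (Y s x - mu a)) -
                      l ^+ 2 / 2 * (pulls A a t x)%:R).
Proof.
elim: t => [|t IH].
  by rewrite /pulls !big_nil !mulr0 subrr expR0.
rewrite pullsS /= /gate => pn; rewrite big_mkcond big_nat_recr //= -big_mkcond /=.
rewrite (IH (leq_trans (leq_addr _ _) pn)).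
case: eqP pn => _ /= pn; last by rewrite addn0 addr0.
have -> : (pulls A a t x < n)%N by rewrite -addn1.
rewrite /tilt -expRD natrD; congr expR.
by ring.
Qed.

Lemma exp_martingale_frozen a n l t x : (n <= pulls A a t x)%N ->
  M a n l t.+1 x = M a n l t x.
Proof. by move=> np; rewrite /= /gate ltnNge np andbF. Qed.

(* For [l = C] and [l = - C], these events cover [n C < `|S|] once [n] pulls have
   been made; they increase with [t] since the supermartingale is then frozen. *)
Definition deviation a n l t : set T :=
  [set x | (n <= pulls A a t x)%N] `&` [set x | expR (n%:R * l ^+ 2 / 2) <= M a n l t x].

Definition bad t : set T := \big[setU/set0]_(a : 'I_K) \big[setU/set0]_(1 <= n < t.+1)
  (deviation a n (C n) t `|` deviation a n (- C n) t).

Lemma measurable_deviation a n l t : measurable (deviation a n l t).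
Proof.
by apply: measurableI;
  [exact: measurable_many_pulls run _ _ _ | exact: measurable_exp_martingale_ge].
Qed.

Lemma deviationS a n l t : deviation a n l t `<=` deviation a n l t.+1.
Proof.
move=> x [/= np Mx]; split=> /=; first by rewrite pullsS (leq_trans np) ?leq_addr.
by have := exp_martingale_frozen l np; rewrite /= => ->.
Qed.

Lemma deviation_prob a n l t :
  (P (deviation a n l t) <= ((expR (n%:R * l ^+ 2 / 2))^-1)%:E)%E.
Proof.
apply: le_trans (exp_martingale_tail run a n l t (expR_gt0 _)).
apply: le_measure; rewrite ?inE; [exact: measurable_deviation | | by move=> x []].
exact: measurable_exp_martingale_ge.
Qed.

Lemma badP t x : bad t x <-> exists a n, (1 <= n <= t)%N /\
  (deviation a n (C n) t x \/ deviation a n (- C n) t x).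
Proof.
rewrite /bad -bigcup_seq; split=> [[a _]|[a [n [nt H]]]].
  rewrite -bigcup_seq => -[n /=]; rewrite mem_index_iota ltnS => nt H.
  by exists a, n.
exists a; first by rewrite /= mem_index_enum.
by rewrite -bigcup_seq; exists n; rewrite /= ?mem_index_iota ?ltnS.
Qed.

(** Monotonicity makes the probability of the union over all times the limit of the [P (bad t)],
    with no further union bound over time. *)
Lemma bad_homo : {homo bad : s t / (s <= t)%N >-> (s <= t)%O}.
Proof.
move=> s t; elim: t => [|t IH]; first by rewrite leqn0 => /eqP->.
rewrite leq_eqVlt => /predU1P[->//|/IH st]; apply: le_trans st _.
rewrite subsetEset => x /badP[a [n [/andP[n1 nt] H]]]; apply/badP; exists a, n.
rewrite n1 (leqW nt); split=> //.
by case: H => H; [left|right]; exact: deviationS.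
Qed.

Lemma measurable_bad t : measurable (bad t).
Proof.
apply: bigsetU_measurable => a _; apply: bigsetU_measurable => n _.
by apply: measurableU; exact: measurable_deviation.
Qed.

Lemma measure_bigsetU_le (I : eqType) (s : seq I) (F : I -> set T) :
  (forall i, i \in s -> measurable (F i)) ->
  (P (\big[setU/set0]_(i <- s) F i) <= \sum_(i <- s) P (F i))%E.
Proof.
elim: s => [_|i s IH mF]; first by rewrite !big_nil measure0.
have ms : measurable (\big[setU/set0]_(j <- s) F j).
  by rewrite big_seq; apply: bigsetU_measurable => j js; apply: mF; rewrite inE js orbT.
have mi : measurable (F i) by apply: mF; rewrite mem_head.
rewrite !big_cons; apply: le_trans (measureU2 _ mi ms) _; apply: leeD => //.
by apply: IH => j js; apply: mF; rewrite inE js orbT.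
Qed.


(** Two signs at [g^2 / (16 n^2)] each sum over [n] to at most [g^2 / 4] per arm, hence to
    [gamma^2 / (4 K) <= gamma] over the arms. *)
Lemma bad_prob t : (P (bad t) <= gamma%:E)%E.
Proof.
have K0 : 0 < K%:R :> R by rewrite ltr0n (leq_trans _ K_ge2).
have [g0 g1] := andP gamma01.
have K1 : 1 <= K%:R :> R by rewrite ler1n (leq_trans _ K_ge2).
have g4 : 0 < g < 4 by rewrite divr_gt0 //= ltr_pdivrMr //; nra.
apply: le_trans (_ : \sum_(a : 'I_K) (g ^+ 2 / 4)%:E <= _)%E; last first.
  rewrite sumEFin lee_fin sumr_const card_ord -[leLHS]mulr_natl.
  have -> : K%:R * (g ^+ 2 / 4) = gamma * (gamma / K%:R / 4) by field; rewrite gt_eqF.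
  rewrite ler_piMr ?(ltW g0) // ler_pdivrMr // ler_pdivrMr //; nra.
apply: le_trans (measure_bigsetU_le _) _.
  move=> a _; apply: bigsetU_measurable => n _.
  by apply: measurableU; exact: measurable_deviation.
apply: lee_sum => a _; apply: le_trans (measure_bigsetU_le _) _.
  by move=> n _; apply: measurableU; exact: measurable_deviation.
apply: le_trans (_ : \sum_(1 <= n < t.+1) (g ^+ 2 / 8 * (n%:R ^+ 2)^-1)%:E <= _)%E.
  rewrite big_seq [leRHS]big_seq; apply: lee_sum => n; rewrite mem_index_iota => /andP[n1 _].
  apply: le_trans (measureU2 _ _ _) _; [exact: measurable_deviation..|].
  have -> : g ^+ 2 / 8 * (n%:R ^+ 2)^-1 =
      g ^+ 2 / 16 * (n%:R ^+ 2)^-1 + g ^+ 2 / 16 * (n%:R ^+ 2)^-1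
    by rewrite -mulrDl; congr (_ * _); lra.
  rewrite EFinD -(expR_conf_radius g4 n1); apply: leeD; first exact: deviation_prob.
  by have := deviation_prob a n (- C n) t; rewrite sqrrN.
rewrite sumEFin lee_fin -mulr_sumr.
have -> : g ^+ 2 / 4 = g ^+ 2 / 8 * 2 by lra.
by rewrite ler_wpM2l ?divr_ge0 ?sqr_ge0 // sum_inv_sqr_le2.
Qed.

(** The union over [n] covers the random number of pulls: take [n] to be its actual value. If
    [S > n C], the exponent at [l = C] is at least [n C^2 / 2]; [l = - C] handles the other sign. *)
Lemma concentrated_outside_bad x : (forall t, ~ bad t x) -> concentrated A Y gamma mu x.
Proof.
move=> good t b Kt; have g0 : 0 < g.
  by rewrite divr_gt0 ?ltr0n ?(leq_trans _ K_ge2) //; case/andP: gamma01.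
have n0 : (0 < pulls A b t x)%N := pulls_gt0 x sampling b Kt.
have nt : (pulls A b t x <= t)%N.
  rewrite /pulls; apply: leq_trans (_ : \sum_(1 <= s < t.+1) 1 <= _)%N.
    by apply: leq_sum => s _; exact: leq_b1.
  by rewrite sum_nat_const_nat subn1 muln1.
set n := pulls A b t x in n0 nt *; have n_gt0 : 0 < n%:R :> R by rewrite ltr0n.
set S := \sum_(1 <= s < t.+1 | A s x == b) (Y s x - mu b).
have SE : S = n%:R * (emp_mean A Y b t x - mu b).
  rewrite /S sumrB /emp_mean -/n mulrBr mulrA divff ?gt_eqF // mul1r; congr (_ - _).
  rewrite /n /pulls natr_sum mulr_suml [LHS]big_mkcond; apply: eq_bigr => s _.
  by case: (_ == _); rewrite ?mul1r ?mul0r.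
have ME l : M b n l t x = expR (l * S - l ^+ 2 / 2 * n%:R) by exact: exp_martingaleE.
have C0 : 0 <= C n by rewrite mulr_ge0 // sqrtr_ge0.
rewrite leNgt; apply/negP; rewrite lter_normr => dev.
apply: (good t); apply/badP; exists b, n; rewrite n0 nt; split=> //.
case/orP: dev => dev; [left|right]; split; rewrite //= ME ler_expR SE.
all: set D := emp_mean _ _ _ _ _ - _ in dev *.
  have : n%:R * (C n * C n) <= n%:R * (C n * D) by rewrite ler_pM2l // ler_wpM2l // ltW.
  nra.
have : n%:R * (C n * C n) <= n%:R * (C n * - D) by rewrite ler_pM2l // ler_wpM2l // ltW.
nra.
Qed.

Lemma exists_concentration_event : exists E : set T,
  [/\ measurable E, ((1 - gamma)%:E <= P E)%E &
    forall x, E x -> concentrated A Y gamma mu x].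
Proof.
have mbad : measurable (\bigcup_t bad t) by apply: bigcup_measurable => t _; exact: measurable_bad.
exists (~` \bigcup_t bad t); split.
- exact: measurableC.
- rewrite probability_setC // EFinB; apply: leeB => //.
  have cv := nondecreasing_cvg_mu (mu := P) measurable_bad mbad bad_homo.
  rewrite -(cvg_lim _ cv) //; apply: lime_le; first by apply/cvg_ex; eexists; exact: cv.
  by apply: nearW => t; exact: bad_prob.
- move=> x nbad; apply: concentrated_outside_bad => t bt.
  by apply: nbad; exists t.
Qed.

End ConcentrationEvent.

(** * Tail and expectation of the stopping time *)

(** Simple functions below [f] are also below [c], so the bound holds for any nonnegative [f],
    measurable or not. *)
Lemma ge0_integral_le_cst d (T : measurableType d) (R : realType) (P : probability T R)
    (f : T -> \bar R) (c : R) :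
  (forall x, 0 <= f x)%E -> (forall x, f x <= c%:E)%E -> (\int[P]_x f x <= c%:E)%E.
Proof.
move=> f0 fc; have PT : (\int[P]_x c%:E)%E = c%:E.
  by rewrite integral_cst // [X in (_ * X)%E]probability_setT mule1.
rewrite -[leRHS]PT !ge0_integralTE // => [|x].
  apply: ge_ereal_sup => _ [h /= hf <-]; apply: ereal_sup_ubound; exists h => // x.
  exact: le_trans (hf x) (fc x).
exact: le_trans (f0 x) (fc x).
Qed.

Theorem theorem5 (R : realType) (K : nat) (hK : (2 <= K)%N)
    (gamma alpha eta : R)
    (hgamma : 0 < gamma < 1) (halpha : 1 <= alpha <= 2) (heta : 0 < eta <= 1)
    (mu : 'I_K -> R) (hmu : unique_best_bandits mu)
    (c : R) (hc : 0 < c) :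
  exists delta0 : R, 0 < delta0 < 1 /\
  forall (d : measure_display) (T : measurableType d) (P : probability T R)
    (A : nat -> T -> 'I_K) (Y : nat -> {RV P >-> R}),
  bandit_run mu A Y -> ebs_sampling A Y gamma ->
  exists E : set T, measurable E /\ ((1 - gamma)%:E <= P E)%E /\
  forall delta : R, 0 < delta <= delta0 ->
  let L := ln (1 / delta) in
  let tau := stop_time A Y (log_threshold c alpha delta) in
  (forall t : nat, (1 + eta) * Tchar mu * L < t%:R ->
     (P ([set x | t%:R%:E < tau x] `&` E) <=
      (2 * K%:R * t%:R *
       expR (- (t%:R * wmin mu / (4 * Tchar mu ^+ 2) *
                (1 / L `^ (2 / 3)))))%:E)%E)
  /\
  (\int[P]_x (tau x * (\1_E x)%:E) <=
   ((1 + eta) * Tchar mu * L +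
    2 ^+ 7 * K%:R * Tchar mu ^+ 4 / wmin mu ^+ 2 *
    expR (- (wmin mu / (4 * Tchar mu) * L `^ (1 / 3))) * L ^+ 2)%:E)%E.
Proof.
have [L0 [L0_gt0 hL0]] := stop_time_le hK hgamma halpha heta hc hmu.
have T0 : 0 < Tchar mu.
  case: hmu => mu01; case E : (best_arm mu) => [a|//] _.
  exact: (Tchar_gt0 hK mu01 (best_arm_max E)).
(* [delta <= exp (- L0)] is the same as [L >= L0]. *)
exists (expR (- L0)); split; first by rewrite expR_gt0 expR_lt1 oppr_lt0.
move=> d T P A Y run sampling.
have [E [mE PE Econc]] := exists_concentration_event hK hgamma run sampling.
exists E; split=> //; split=> // delta /andP[delta_gt0 delta_le] L tau.
have L0L : L0 <= L.
  by rewrite /L div1r lnV ?posrE // lerNr -[- L0]expRK ler_ln ?posrE ?expR_gt0.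
have tau_le x : E x -> (tau x <= ((1 + eta) * Tchar mu * L)%:E)%E.
  by move=> Ex; exact: hL0 sampling (Econc x Ex) _ delta_gt0 L0L.
have tau_ge0 x : (0 <= tau x)%E.
  by apply: le_ereal_inf_tmp => _ [t _ <-]; rewrite lee_fin.
have [eta_gt0 _] := andP heta.
have L_gt0 : 0 < L by exact: lt_le_trans L0L.
have TL_ge0 : 0 <= (1 + eta) * Tchar mu * L.
  by rewrite !mulr_ge0 ?addr_ge0 // ltW.
split=> [t t_gt|].
  rewrite (_ : _ `&` E = set0); last first.
    rewrite -subset0 => x [/= t_tau /tau_le tau_TL].
    by have := lt_le_trans t_tau tau_TL; rewrite lte_fin ltNge (ltW t_gt).
  by rewrite measure0 lee_fin !mulr_ge0 ?expR_ge0.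
apply: le_trans (_ : ((1 + eta) * Tchar mu * L)%:E <= _)%E.
  (* Outside [E] the integrand is 0 even where [tau] is infinite, since [+oo * 0 = 0]. *)
  apply: ge0_integral_le_cst => x; rewrite indicE; have [Ex|nEx] := boolP (x \in E).
  - by rewrite mule1.
  - by rewrite mule0.
  - by rewrite mule1; apply: tau_le; rewrite inE in Ex.
  - by rewrite mule0.
rewrite lee_fin lerDl mulr_ge0 ?sqr_ge0 // mulr_ge0 ?expR_ge0 // divr_ge0 ?sqr_ge0 //.
by rewrite mulr_ge0 ?(exprn_ge0 _ (ltW T0)) // mulr_ge0 // exprn_ge0.
Qed.
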